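(* Let $\mu$ and $\tilde\mu$ be two probability measures supported on a compact interval $I\subset\mathbb{R}$, with $\mu$ satisfying the standing assumptions below. Let $\nu^{(k)}$ be a solution to $\min_{\lambda\in\mathcal{P}_k(\mathbb{R})}W_1(\mu,\lambda)$ with support points $y_1\le\dots\le y_k$, let $\tilde y_1\le\dots\le\tilde y_k$ be the support points of a solution to $\min_{\lambda\in\mathcal{P}_k(\mathbb{R})}W_1(\tilde\mu,\lambda)$, and set $\vec v_\mu=(F_\mu(y_j))_{j\in[k]}$ and $\vec v_{\tilde\mu}=(F_{\tilde\mu}(\tilde y_j))_{j\in[k]}$. Let $\vec X_n$ be $n$ i.i.d. random variables with law $\mu$. Then \[ \lim_{n\to\infty}\Bigg|\frac{\mathbb{E}[SC_{\vec v_{\tilde\mu}}(\vec X_n)]}{\mathbb{E}[SC_{opt}(\vec X_n)]}-1\Bigg|\le\frac{W_\infty(\mu,\tilde\mu)+2W_1(\mu,\tilde\mu)}{W_1(\mu,\nu^{(k)})}\le 3\,\frac{W_\infty(\mu,\tilde\mu)}{W_1(\mu,\nu^{(k)})}. \] Moreover, for every $n>k$ there exists a constant $C>0$ such that \[ \big|B^{(n)}_{ar}(\mathcal{PM}_{\vec v_\mu})-B^{(n)}_{ar}(\mathcal{PM}_{\vec v_{\tilde\mu}})\big|\le 3\,\frac{W_\infty(\mu,\tilde\mu)}{W_1(\mu,\nu^{(k)})}+\frac{C}{\sqrt n}. \]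
   Context: For $\vec x\in\mathbb{R}^n$, $\vec y\in\mathbb{R}^k$: $SC(\vec x,\vec y)=\frac1n\sum_i\min_j|x_i-y_j|$, $SC_{opt}(\vec x)=\min_{\vec y}SC(\vec x,\vec y)$. A percentile vector is $\vec v$ with $0\le v_1\le\dots\le v_k\le1$; $\mathcal{PM}_{\vec v}$ sorts the reports $x_{(1)}\le\dots\le x_{(n)}$ and places facility $j$ at $x_{(\lfloor(n-1)v_j\rfloor+1)}$; $SC_{\vec v}(\vec x)$ is the Social Cost of its output. $B^{(n)}_{ar}(f)=\mathbb{E}[SC_f(\vec X_n)]/\mathbb{E}[SC_{opt}(\vec X_n)]$, expectations with respect to the agents' true law $\mu$. $\mathcal{P}_k(\mathbb{R})$: probability measures $\sum_{j=1}^k\nu_j\delta_{x_j}$ ($\nu_j\ge0$, $\sum\nu_j=1$). $W_1(\alpha,\beta)=\min_{\pi\in\Pi(\alpha,\beta)}\int|x-y|d\pi$ and $W_\infty(\alpha,\beta)=\min_{\pi\in\Pi(\alpha,\beta)}\max_{(x,y)\in\mathrm{spt}(\pi)}|x-y|$, $\Pi(\alpha,\beta)$ being the couplings. $F_\eta$ denotes the c.d.f. of $\eta$. Standing assumptions on $\mu$: absolutely continuous with density $\rho_\mu$; support an interval on whose interior $\rho_\mu>0$; $\rho_\mu$ differentiable on the support. *)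

(* Defs.v *)
From HB Require Import structures.
From mathcomp Require Import all_boot all_order all_algebra.
From mathcomp Require Import all_classical all_reals all_analysis.
Set Implicit Arguments. Unset Strict Implicit. Unset Printing Implicit Defensive.
Import Order.TTheory GRing.Theory Num.Theory.
Import numFieldNormedType.Exports.
Local Open Scope classical_set_scope.
Local Open Scope ring_scope.

Section Defs.
Variable R : realType.

(* min_j |x - y_j| for a nonempty list y *)
Definition dist_to (x : R) (y : seq R) : R :=
  \big[Num.min/`|x - head 0 y|]_(yj <- y) `|x - yj|.

Definition SC (x y : seq R) : R :=
  (size x)%:R^-1 * \sum_(xi <- x) dist_to xi y.

Definition SCopt (k : nat) (x : seq R) : R :=
  inf [set SC x y | y in [set y : seq R | size y = k]].

(* percentile mechanism: facility j at x_(floor((n-1) v_j) + 1) (1-indexed)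
   i.e. at index floor((n-1) v_j) (0-indexed) of the sorted reports *)
Definition PM (v : seq R) (x : seq R) : seq R :=
  [seq nth 0 (sort <=%R x) `|Num.floor (((size x)%:R - 1) * vj)|%N | vj <- v].

Definition SCv (v : seq R) (x : seq R) : R := SC x (PM v x).

(* E[f(X_1,...,X_n)] for X_1..X_n i.i.d. with law mu, as an iterated integral
   (equal to the integral w.r.t. the product measure by Tonelli, f >= 0). *)
Fixpoint iidE (mu : probability R R) (n : nat) (f : seq R -> \bar R) : \bar R :=
  match n with
  | 0 => f [::]
  | n'.+1 => (\int[mu]_x iidE mu n' (fun s => f (x :: s)))%E
  end.

Definition Eiid (mu : probability R R) (n : nat) (g : seq R -> R) : \bar R :=
  iidE mu n (fun s => (g s)%:E).

Definition Bar (mu : probability R R) (k n : nat) (v : seq R) : R :=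
  fine (Eiid mu n (SCv v)) / fine (Eiid mu n (SCopt k)).

Definition cdfmu (mu : probability R R) (y : R) : R := fine (mu [set` `]-oo, y]]).

Definition coupling (a b : probability R R) (pi : probability (R * R)%type R) :=
  (forall A, measurable A -> pi (A `*` setT) = a A) /\
  (forall B, measurable B -> pi (setT `*` B) = b B).

Definition W1 (a b : probability R R) : \bar R :=
  ereal_inf [set (\int[pi]_z (`|z.1 - z.2|)%:E)%E
            | pi in [set pi | coupling a b pi]].

(* max over spt(pi) of |x-y|, written as the pi-essential sup of the continuous
   function |x - y|, minimized over couplings *)
Definition Winf (a b : probability R R) : \bar R :=
  ereal_inf [set c%:E | c in [set c : R | exists pi, coupling a b pi /\
                                   pi [set z | c < `|z.1 - z.2|] = 0%E]].

Definition is_discrete_k (k : nat) (lam : probability R R)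
    (x : 'I_k -> R) (w : 'I_k -> R) :=
  (forall j, 0 <= w j) /\ \sum_j w j = 1 /\
  (forall A, measurable A -> lam A = (\sum_j (w j)%:E * \d_(x j) A)%E).

Definition in_Pk (k : nat) (lam : probability R R) :=
  exists (x w : 'I_k -> R), is_discrete_k lam x w.

Definition W1_opt (k : nat) (mu nu : probability R R) :=
  in_Pk k nu /\ forall lam, in_Pk k lam -> (W1 mu nu <= W1 mu lam)%E.

Definition sorted_support (k : nat) (nu : probability R R) (y : 'I_k -> R) :=
  (forall i j : 'I_k, (i <= j)%N -> y i <= y j) /\
  exists w, (forall j, 0 < w j) /\ is_discrete_k nu y w.

Definition spt (mu : probability R R) : set R :=
  [set x | forall U, open U -> U x -> (0 < mu U)%E].

Definition standing (mu : probability R R) :=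
  exists rho : R -> R,
    measurable_fun setT rho /\ (forall x, 0 <= rho x) /\
    (forall A, measurable A ->
       mu A = (\int[lebesgue_measure]_(x in A) (rho x)%:E)%E) /\
    exists a b : R, a < b /\ spt mu = [set` `[a, b]] /\
      (forall x, a < x < b -> 0 < rho x) /\
      (forall x, x \in `[a, b] -> exists l : R,
         ((fun y => (rho y - rho x) / (y - x)) @
            within [set y | y \in `[a, b] /\ y != x] (nbhs x)) --> l).

End Defs.

(* Main.v *)
Require Import Defs.
From HB Require Import structures.
From mathcomp Require Import all_boot all_order all_algebra.
From mathcomp Require Import all_classical all_reals all_analysis.
From mathcomp Require Import measurable_realfun.
From mathcomp Require Import ring lra.
Import Order.TTheory GRing.Theory Num.Theory.
Import numFieldNormedType.Exports.
Local Open Scope classical_set_scope.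
Local Open Scope ring_scope.
Set Implicit Arguments. Unset Strict Implicit. Unset Printing Implicit Defensive.

(** Write [D ys] for the mu-mean distance to the points [ys]: the optimal
    quantizer satisfies W_1(mu, nu) = min D, and [D] is 1-Lipschitz for W_1 in
    the law and for the sup norm in [ys].  The percentile mechanism with vector
    F_mut(yt_j) places its facilities near the mu-quantiles q_j of these levels;
    a coupling with |x - x'| <= w sandwiches F_mut between shifts of F_mu by w,
    so |q_j - yt_j| <= w once yt_j is clipped to the w-neighbourhood of the
    support, whence D q <= min D + W_inf + 2 W_1.

    All sampling errors are controlled by second moments of F_n(t) - F(t): the
    social cost by Abel summation over a grid, the order statistics by
    Chebyshev at distance i / sqrt n from q_j, where the density is bounded
    below.  At the endpoints of the support, where the density may vanish, only
    consistency holds for the limit, but the rate is only needed from above, and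
    there an extreme order statistic serves the sample at least as well as the
    endpoint.  Every ratio is at least 1, so the upper bounds suffice for the
    difference of two ratios; the finitely many small n are absorbed in C. *)

(** * Monotonicity of the integral up to null sets *)

Section IntegralMonotone.
Context (d : measure_display) (T : measurableType d) (R : realType).
Variable P : {measure set T -> \bar R}.
Implicit Types f g : T -> \bar R.
Import HBNNSimple.
Local Open Scope ereal_scope.

(* The library's integral is a supremum over simple functions below the
   integrand, so monotonicity needs no measurability of [f] or [g]. *)
Let ge0_le_integral_null (A : set T) f g : measurable A -> P (~` A) = 0 ->
  (forall x, 0 <= f x) -> (forall x, 0 <= g x) ->
  (forall x, A x -> f x <= g x) -> \int[P]_x f x <= \int[P]_x g x.
Proof.
move=> mA PA f0 g0 fg; rewrite !ge0_integralTE//.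
apply: ge_ereal_sup => _ [h /= hf <-].
have -> : sintegral P h = \int[P]_x (h x)%:E.
  by rewrite integral_nnsfun// patch_setT.
have mh : measurable_fun [set: T] (EFin \o h) by apply/measurable_EFinP.
rewrite (@ge0_negligible_integral _ _ _ P setT (~` A))//; last 2 first.
- exact: measurableC.
- by move=> x _; rewrite lee_fin.
rewrite setTD setCK integral_nnsfun//.
apply: ereal_sup_ubound; exists (proj_nnsfun h mA) => //=.
  move=> x; rewrite mindicE; case: (boolP (x \in A)) => xA /=.
    by rewrite mulr1 (le_trans (hf x))// fg// -[A x]inE.
  by rewrite mulr0.
by rewrite -mrestrict.
Qed.

(** Positive and negative parts are compared separately. The null set allows later estimates to be
    checked only for reports inside the support. *)
Lemma le_integral_null (A : set T) f g : measurable A -> P (~` A) = 0 ->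
  (forall x, A x -> f x <= g x) -> \int[P]_x f x <= \int[P]_x g x.
Proof.
move=> mA PA fg; rewrite integralE [leRHS]integralE; apply: leeB.
  apply: (ge0_le_integral_null mA PA) => // x Ax.
  by rewrite !funeposE ge_max le_max fg//= le_max lexx orbT.
apply: (ge0_le_integral_null mA PA) => // x Ax.
by rewrite !funenegE ge_max le_max leeN2 fg//= le_max lexx orbT.
Qed.

End IntegralMonotone.

(** * Iterated expectations over i.i.d. samples *)

Section IidMean.
Context (R : realType) (mu : probability R R).

(** Coordinates are integrated one at a time, each comparison holding off a null set. This serves
    [SCv] and [SCopt] directly as integrands: they are squeezed between functions whose mean is
    known to exist. *)
Lemma le_iidE (A : set R) n (f g : seq R -> \bar R) : measurable A ->
  mu (~` A) = 0%E ->
  (forall s, size s = n -> (forall x, x \in s -> A x) -> (f s <= g s)%E) ->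
  (iidE mu n f <= iidE mu n g)%E.
Proof.
move=> mA muA; elim: n f g => [|n IH] f g fg /=; first exact: fg.
apply: (le_integral_null mA muA) => x Ax; apply: IH => s sn sA.
apply: fg => /=; first by rewrite sn.
by move=> z; rewrite inE => /predU1P[->//|]; exact: sA.
Qed.

(* [iid_mean n f m]: the iterated integral of [f] over [n] i.i.d. points exists
   with integrable integrands at every stage, and its value is [m]. *)
Fixpoint iid_mean n (f : seq R -> R) (m : R) : Prop :=
  match n with
  | 0 => f [::] = m
  | n'.+1 => exists G : R -> R, [/\ mu.-integrable setT (EFin \o G),
      forall x, iid_mean n' (fun s => f (x :: s)) (G x)
      & (\int[mu]_x (G x)%:E = m%:E)%E]
  end.

Lemma iid_mean_Eiid n f m : iid_mean n f m -> Eiid mu n f = m%:E.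
Proof.
elim: n f m => [|n IH] f m /=; first by rewrite /Eiid/= => ->.
case=> G [iG fG <-]; rewrite /Eiid/=; apply: eq_integral => x _.
exact: IH (fG x).
Qed.

Let integral_cst_prob (c : R) : (\int[mu]_x (EFin \o cst c) x = c%:E)%E.
Proof.
by rewrite (_ : EFin \o cst c = cst c%:E)// integral_cst//= probability_setT mule1.
Qed.

Lemma iid_mean_cst n (c : R) : iid_mean n (fun=> c) c.
Proof.
elim: n => [//|n IH] /=; exists (fun=> c); split => //.
  exact: finite_measure_integrable_cst.
exact: integral_cst_prob.
Qed.

Lemma iid_meanD n f g m p : iid_mean n f m -> iid_mean n g p ->
  iid_mean n (fun s => f s + g s) (m + p).
Proof.
elim: n f g m p => [|n IH] f g m p /=; first by move=> -> ->.
move=> [F [iF fF EF]] [G [iG gG EG]]; exists (fun x => F x + G x); split.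
- exact: (integrableD measurableT iF iG).
- by move=> x; exact: IH.
- by rewrite (integralD measurableT iF iG) EF EG.
Qed.

Lemma iid_meanZ n (c : R) f m : iid_mean n f m ->
  iid_mean n (fun s => c * f s) (c * m).
Proof.
elim: n f m => [|n IH] f m /=; first by move=> ->.
move=> [F [iF fF EF]]; exists (fun x => c * F x); split.
- exact: (integrableZl measurableT _ iF).
- by move=> x; exact: IH.
- by rewrite (integralZl measurableT iF) EF.
Qed.

Lemma iid_mean_sum (I : Type) (r : seq I) n (f : I -> seq R -> R) (m : I -> R) :
  (forall i, iid_mean n (f i) (m i)) ->
  iid_mean n (fun s => \sum_(i <- r) f i s) (\sum_(i <- r) m i).
Proof.
move=> fm; elim: r => [|i r IH].
  rewrite big_nil.
  have -> : (fun s => \sum_(i <- [::]) f i s) = fun=> 0.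
    by apply/funext => s; rewrite big_nil.
  exact: iid_mean_cst.
rewrite big_cons.
have -> : (fun s => \sum_(j <- i :: r) f j s) =
    (fun s => f i s + \sum_(j <- r) f j s).
  by apply/funext => s; rewrite big_cons.
exact: iid_meanD.
Qed.

Lemma iid_mean_sum_fun n (h : R -> R) m : mu.-integrable setT (EFin \o h) ->
  (\int[mu]_x (h x)%:E = m%:E)%E ->
  iid_mean n (fun s => \sum_(x <- s) h x) (n%:R * m).
Proof.
move=> ih hm; elim: n => [|n IH] /=; first by rewrite big_nil mul0r.
have ic : mu.-integrable setT (EFin \o cst (n%:R * m)).
  exact: finite_measure_integrable_cst.
exists (fun x => h x + n%:R * m); split.
- exact: (integrableD measurableT ih ic).
- move=> x.
  have -> : (fun s => \sum_(y <- x :: s) h y) = (fun s => h x + \sum_(y <- s) h y).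
    by apply/funext => s; rewrite big_cons.
  exact: iid_meanD (iid_mean_cst _ _) IH.
- rewrite (integralD measurableT ih ic) hm integral_cst_prob.
  by rewrite -EFinD -natr1 mulrDl mul1r addrC.
Qed.

(** Additivity of the variance. The offset [b] makes the induction work: the first draw is absorbed
    into [b], and the cross term [2 * b * g x] integrates to zero. *)
Lemma iid_mean_sqr_sum n (g : R -> R) (v b : R) :
  mu.-integrable setT (EFin \o g) -> (\int[mu]_x (g x)%:E = 0)%E ->
  mu.-integrable setT (fun x => (g x ^+ 2)%:E) ->
  (\int[mu]_x (g x ^+ 2)%:E = v%:E)%E ->
  iid_mean n (fun s => (b + \sum_(x <- s) g x) ^+ 2) (b ^+ 2 + n%:R * v).
Proof.
move=> ig g0 ig2 g2; elim: n b => [|n IH] b /=.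
  by rewrite big_nil addr0 mul0r addr0.
have i2 := integrableZl measurableT (2 * b) ig.
have ic : mu.-integrable setT (EFin \o cst (b ^+ 2 + n%:R * v)).
  exact: finite_measure_integrable_cst.
have i12 := integrableD measurableT ig2 i2.
exists (fun x => (b + g x) ^+ 2 + n%:R * v).
have E x : ((b + g x) ^+ 2 + n%:R * v)%:E =
   ((g x ^+ 2)%:E + (2 * b)%:E * (g x)%:E + (b ^+ 2 + n%:R * v)%:E)%E.
  by rewrite -!EFinM -!EFinD; congr EFin; ring.
split.
- have -> : EFin \o (fun x => (b + g x) ^+ 2 + n%:R * v) = fun x =>
   ((g x ^+ 2)%:E + (2 * b)%:E * (g x)%:E + (b ^+ 2 + n%:R * v)%:E)%E.
    by apply/funext => x; exact: E.
  exact: (integrableD measurableT i12 ic).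
- move=> x.
  have -> : (fun s => (b + \sum_(y <- x :: s) g y) ^+ 2) =
      (fun s => ((b + g x) + \sum_(y <- s) g y) ^+ 2).
    by apply/funext => s; rewrite big_cons addrA.
  exact: IH.
- under eq_integral do rewrite E.
  rewrite (integralD measurableT i12 ic) (integralD measurableT ig2 i2).
  rewrite (integralZl measurableT ig) g0 g2 mule0 adde0 integral_cst_prob.
  rewrite -EFinD; congr EFin.
  by rewrite -natr1; ring.
Qed.

End IidMean.

(** * Distance to a finite list of facilities *)

Section DistTo.
Context (R : realType).
Implicit Types (x y : R) (ys : seq R).

Lemma dist_to_le x y ys : y \in ys -> dist_to x ys <= `|x - y|.
Proof.
rewrite /dist_to; move: `|x - head 0 ys| => z.
elim: ys => [//|u ys IH]; rewrite inE big_cons => /predU1P[->|/IH uys].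
  by rewrite ge_min lexx.
by rewrite ge_min uys orbT.
Qed.

Lemma dist_to_ex x ys : ys != [::] -> exists2 y, y \in ys & dist_to x ys = `|x - y|.
Proof.
case: ys => // y0 ys _; rewrite /dist_to /=.
suff : forall zs, {subset zs <= y0 :: ys} ->
    exists2 y, y \in y0 :: ys & \big[Num.min/`|x - y0|]_(yj <- zs) `|x - yj| = `|x - y|.
  exact.
elim=> [_|z zs IH zsub].
  by exists y0; rewrite ?big_nil// mem_head.
have [|y yin yE] := IH; first by move=> t tz; apply: zsub; rewrite inE tz orbT.
rewrite big_cons yE; case: (leP `|x - z| `|x - y|) => _.
  by exists z => //; apply: zsub; rewrite mem_head.
by exists y.
Qed.

Lemma dist_to_ge0 x ys : 0 <= dist_to x ys.
Proof.
rewrite /dist_to; elim: {2}ys => [|y zs IH]; first by rewrite big_nil.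
by rewrite big_cons le_min normr_ge0.
Qed.

(** It suffices to test the left-hand minimum at the index that is nearest for [g]. *)
Lemma dist_to_map_le (I : eqType) (l : seq I) (f g : I -> R) x (e : R) :
  l != [::] -> (forall j, j \in l -> `|x - f j| <= `|x - g j| + e) ->
  dist_to x (map f l) <= dist_to x (map g l) + e.
Proof.
move=> l0 fg; have [|_ /mapP[j jl ->] ->] := @dist_to_ex x (map g l).
  by case: l l0 {fg}.
by apply: le_trans (fg _ jl); apply: dist_to_le; exact: map_f.
Qed.

Lemma dist_to_lipschitz x x' ys : ys != [::] ->
  dist_to x ys <= dist_to x' ys + `|x - x'|.
Proof.
move=> /(dist_to_ex x')[y yys ->]; apply: le_trans (dist_to_le x yys) _.
by rewrite [leRHS]addrC ler_distD.
Qed.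

Lemma measurable_dist_to ys : measurable_fun setT (fun x => dist_to x ys).
Proof.
rewrite /dist_to; elim: {2}ys => [|y zs IH].
  under eq_fun do rewrite big_nil.
  by apply: measurableT_comp => //; exact: measurable_funB.
under eq_fun do rewrite big_cons.
apply: measurable_minr => //.
by apply: measurableT_comp => //; exact: measurable_funB.
Qed.

End DistTo.

#[global] Hint Resolve measurable_dist_to : core.

(** * Mean distance to the facilities and transport costs *)

Section QuantizationCost.
Context (R : realType).
Implicit Types (a b mu : probability R R) (ys : seq R).
Local Open Scope ereal_scope.

(** The functional [D] of the overview. *)
Definition qcost mu ys : \bar R := \int[mu]_x (dist_to x ys)%:E.

Lemma qcost_ge0 mu ys : 0 <= qcost mu ys.
Proof. by apply: integral_ge0 => x _; rewrite lee_fin dist_to_ge0. Qed.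

Lemma coupling_integral1 a b (pi : probability (R * R)%type R) (f : R -> R) :
  coupling a b pi -> measurable_fun setT f -> (forall x, (0 <= f x)%R) ->
  \int[pi]_z (f z.1)%:E = \int[a]_x (f x)%:E.
Proof.
move=> [pia _] mf f0.
rewrite [RHS](@eq_measure_integral _ _ _ setT (pushforward pi fst)); last first.
  move=> A mA _; rewrite /pushforward; apply: etrans (esym (pia A mA)) _.
  by congr (pi _); apply/seteqP; split => z //=; case.
rewrite ge0_integral_pushforward//=.
- exact/measurable_EFinP.
- by move=> x _; rewrite lee_fin.
Qed.

Lemma coupling_integral2 a b (pi : probability (R * R)%type R) (f : R -> R) :
  coupling a b pi -> measurable_fun setT f -> (forall x, (0 <= f x)%R) ->
  \int[pi]_z (f z.2)%:E = \int[b]_x (f x)%:E.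
Proof.
move=> [_ pib] mf f0.
rewrite [RHS](@eq_measure_integral _ _ _ setT (pushforward pi snd)); last first.
  move=> A mA _; rewrite /pushforward; apply: etrans (esym (pib A mA)) _.
  by congr (pi _); apply/seteqP; split => z //=; case.
rewrite ge0_integral_pushforward//=.
- exact/measurable_EFinP.
- by move=> x _; rewrite lee_fin.
Qed.

Definition transport_cost (pi : probability (R * R)%type R) : \bar R :=
  \int[pi]_z (`|z.1 - z.2|)%:E.

Lemma transport_cost_ge0 (pi : probability (R * R)%type R) :
  0 <= transport_cost pi.
Proof. by apply: integral_ge0 => z _; rewrite lee_fin. Qed.

Lemma measurable_dist2 : measurable_fun setT (fun z : R * R => `|z.1 - z.2|%R).
Proof. by apply: measurableT_comp => //; exact: measurable_funB. Qed.

Let measurable_dist_to1 ys :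
  measurable_fun setT (fun z : R * R => (dist_to z.1 ys)%:E).
Proof.
by apply/measurable_EFinP; exact: (measurableT_comp (measurable_dist_to ys)).
Qed.

Let measurable_dist_to2 ys :
  measurable_fun setT (fun z : R * R => (dist_to z.2 ys)%:E).
Proof.
by apply/measurable_EFinP; exact: (measurableT_comp (measurable_dist_to ys)).
Qed.

Let measurable_Edist2 :
  measurable_fun setT (fun z : R * R => (`|z.1 - z.2|%R)%:E).
Proof. by apply/measurable_EFinP; exact: measurable_dist2. Qed.

(** The 1-Lipschitz bound on the distance function is integrated against the coupling, the easy half
    of Kantorovich duality. *)
Lemma qcost_coupling1 a b pi ys : coupling a b pi -> ys != [::] ->
  qcost a ys <= qcost b ys + transport_cost pi.
Proof.
move=> cpi ys0; rewrite /qcost.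
rewrite -(coupling_integral1 cpi (measurable_dist_to ys) (fun x => dist_to_ge0 x ys)).
rewrite -(coupling_integral2 cpi (measurable_dist_to ys) (fun x => dist_to_ge0 x ys)).
rewrite -ge0_integralD//; last first.
  by move=> z _; rewrite lee_fin dist_to_ge0.
apply: (@le_integral_null _ _ _ pi setT) => //; first by rewrite setCT measure0.
by move=> z _; rewrite -EFinD lee_fin dist_to_lipschitz.
Qed.

Lemma qcost_coupling2 a b pi ys : coupling a b pi -> ys != [::] ->
  qcost b ys <= qcost a ys + transport_cost pi.
Proof.
move=> cpi ys0; rewrite /qcost.
rewrite -(coupling_integral1 cpi (measurable_dist_to ys) (fun x => dist_to_ge0 x ys)).
rewrite -(coupling_integral2 cpi (measurable_dist_to ys) (fun x => dist_to_ge0 x ys)).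
rewrite -ge0_integralD//; last first.
  by move=> z _; rewrite lee_fin dist_to_ge0.
apply: (@le_integral_null _ _ _ pi setT) => //; first by rewrite setCT measure0.
by move=> z _; rewrite -EFinD lee_fin distrC dist_to_lipschitz.
Qed.

Lemma coupling_null1 a b pi (A : set R) : coupling a b pi -> measurable A ->
  a A = 0 -> pi (fst @^-1` A) = 0.
Proof.
move=> [pia _] mA aA; rewrite -aA -pia//.
by congr (pi _); apply/seteqP; split => z //=; case.
Qed.

Lemma coupling_null2 a b pi (A : set R) : coupling a b pi -> measurable A ->
  b A = 0 -> pi (snd @^-1` A) = 0.
Proof.
move=> [_ pib] mA bA; rewrite -bA -pib//.
by congr (pi _); apply/seteqP; split => z //=; case.
Qed.

Lemma measurable_mem_seq ys : measurable [set x : R | x \in ys].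
Proof.
elim: ys => [|y ys IH].
  by rewrite (_ : [set _ | _] = set0)//; apply/seteqP; split => x.
rewrite (_ : [set _ | _] = [set y] `|` [set x | x \in ys]).
  exact: measurableU.
apply/seteqP; split => x /=; rewrite inE.
  by move=> /predU1P[->|xy]; [left|right].
by move=> [->|->]; rewrite ?eqxx ?orbT.
Qed.

(** Under any coupling the second coordinate is almost surely an atom of [nu], so the transport
    distance dominates the distance to the nearest atom. *)
Lemma qcost_le_W1 k mu nu (y w : 'I_k -> R) : (0 < k)%N ->
  is_discrete_k nu y w -> qcost mu (map y (enum 'I_k)) <= W1 mu nu.
Proof.
move=> k0 [w0 [w1 nuE]]; apply: le_ereal_inf_tmp => _ [pi cpi <-].
set ys := map y _.
have m1 := measurable_mem_seq ys.
rewrite /qcost -(coupling_integral1 cpi (measurable_dist_to ys) (fun x => dist_to_ge0 x ys)).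
apply: (@le_integral_null _ _ _ pi (snd @^-1` [set x | x \in ys])).
- by rewrite -[_ @^-1` _]setTI; exact: measurable_snd.
- rewrite preimage_setC; apply: (coupling_null2 cpi); first exact: measurableC.
  rewrite nuE; last exact: measurableC.
  rewrite big1// => j _; rewrite diracE memNset ?mule0//=.
  by apply; apply: map_f; rewrite mem_enum.
- by move=> z zy; rewrite lee_fin dist_to_le.
Qed.

End QuantizationCost.

(** * Optimal quantizers as minimizers of the mean distance *)

Section OptimalQuantizer.
Context (R : realType).
Implicit Types (mu nu lam : probability R R) (ys : seq R).

(** Mass is collected point by point. A point that recurs later in the list gets weight zero at its
    earlier place, so repetitions are counted once. *)
Lemma finite_support_weights lam ys : exists w : nat -> R, (forall i, 0 <= w i) /\
  forall A, measurable A -> lam (A `&` [set x | x \in ys]) =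
    (\sum_(i < size ys) (w i)%:E * \d_(nth 0%R ys i) A)%E.
Proof.
elim: ys => [|y ys [w [w0 wE]]].
  exists (fun=> 0); split=> // A mA; rewrite big_ord0.
  by rewrite (_ : [set _ | _] = set0) ?setI0 ?measure0//; apply/seteqP; split=> x.
have [yys|yys] := boolP (y \in ys).
  exists (fun i => if i is i'.+1 then w i' else 0); split; first by case.
  move=> A mA; rewrite big_ord_recl /= mul0e add0e.
  rewrite (_ : [set x | x \in y :: ys] = [set x | x \in ys]) ?wE//.
  apply/seteqP; split=> x /=; rewrite inE; last by move=> ->; rewrite orbT.
  by move=> /predU1P[->|].
exists (fun i => if i is i'.+1 then w i' else fine (lam [set y])); split.
  by case=> // ; rewrite fine_ge0.
move=> A mA; rewrite big_ord_recl /= -wE// fineK ?fin_num_measure//.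
rewrite (_ : A `&` [set x | x \in y :: ys] =
  (A `&` [set y]) `|` (A `&` [set x | x \in ys])); last first.
  rewrite -setIUr; congr (_ `&` _); apply/seteqP; split => x /=; rewrite inE.
    by move=> /predU1P[->|xy]; [left|right].
  by move=> [->|->]; rewrite ?eqxx ?orbT.
have m1 := measurable_mem_seq ys.
rewrite measureU//.
- congr (_ + _)%E; rewrite diracE; have [yA|yA] := boolP (y \in A).
    rewrite mule1; congr (lam _); apply: setIidr => x ->; exact: set_mem.
  rewrite mule0 (_ : _ `&` _ = set0) ?measure0//.
  by apply/seteqP; split => x // [Ax xy]; move: yA; rewrite -xy (mem_set Ax).
- exact: measurableI.
- exact: measurableI.
- apply/seteqP; split => x // [[_ /= ->]] [_ /= yys'].
  by rewrite yys' in yys.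
Qed.

Lemma finite_support_in_Pk lam ys : lam (~` [set x | x \in ys]) = 0%E ->
  in_Pk (size ys) lam.
Proof.
move=> lam0; have [w [w0 wE]] := finite_support_weights lam ys.
have m1 := measurable_mem_seq ys.
have lamE A : measurable A ->
    lam A = (\sum_(i < size ys) (w i)%:E * \d_(nth 0%R ys i) A)%E.
  move=> mA; rewrite -wE// -[in LHS](setIT A) -(setUCr [set x | x \in ys]) setIUr.
  rewrite measureU//.
  - rewrite [X in (_ + X)%E](_ : _ = 0%E) ?adde0//.
    apply: subset_measure0 lam0 => //; first exact/measurableI/measurableC.
    exact: measurableC.
  - exact: measurableI.
  - exact/measurableI/measurableC.
  - by apply/seteqP; split=> x //= -[[_ ?] [_]]; apply.
exists (fun i => nth 0 ys i), (fun i : 'I_(size ys) => w i); split => //; split => //.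
apply: EFin_inj; rewrite -sumEFin -(@probability_setT _ _ _ lam) lamE//.
by apply: eq_bigr => i _; rewrite diracT mule1.
Qed.

(** Measurable projection onto the Voronoi cells of [y0 :: ys]; the order of the tests settles
    ties. *)
Fixpoint nearest (y0 : R) (ys : seq R) (x : R) : R :=
  if ys is y :: ys' then
    if `|x - y| <= `|x - nearest y0 ys' x| then y else nearest y0 ys' x
  else y0.

Lemma measurable_nearest y0 ys : measurable_fun setT (nearest y0 ys).
Proof.
elim: ys => [|y ys IH] /=; first exact: measurable_cst.
apply: measurable_fun_ifT => //.
by apply: measurable_fun_ler; apply: measurableT_comp => //; exact: measurable_funB.
Qed.

Lemma nearest_in y0 ys x : nearest y0 ys x \in y0 :: ys.
Proof.
elim: ys => [|y ys IH] /=; first exact: mem_head.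
case: ifP => _; first by rewrite !inE eqxx orbT.
by move: IH; rewrite !inE => /orP[->|->]; rewrite ?orbT.
Qed.

Lemma nearest_le y0 ys x y : y \in y0 :: ys -> `|x - nearest y0 ys x| <= `|x - y|.
Proof.
elim: ys => [|z ys IH] /=; first by rewrite inE => /eqP->.
rewrite !inE orbCA => /predU1P[->|yin]; first by case: ifP => // /negbT; rewrite -ltNge => /ltW.
by case: ifP => [zle|_]; [apply: le_trans zle _|]; apply: IH; rewrite inE.
Qed.

Lemma nearest_dist y0 ys x : `|x - nearest y0 ys x| = dist_to x (y0 :: ys).
Proof.
apply/eqP; rewrite eq_le (dist_to_le x (nearest_in y0 ys x)) andbT.
have [//|y yin ->] := @dist_to_ex R x (y0 :: ys).
exact: nearest_le.
Qed.

(** Push [mu] forward along [nearest]. The image law sits on [ys], and the joint law of a point and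
    its projection is a coupling whose cost is exactly [qcost mu ys]. *)
Lemma W1_le_qcost mu ys : ys != [::] ->
  exists2 lam : probability R R, in_Pk (size ys) lam & (W1 mu lam <= qcost mu ys)%E.
Proof.
case: ys => // y0 ys _; set ys' := y0 :: ys.
have mp := measurable_nearest y0 ys.
have mG : measurable_fun setT (fun x => (x, nearest y0 ys x)).
  exact: measurable_fun_pair.
pose p : {mfun R >-> R} := mfun_Sub (mem_set mp : nearest y0 ys \in mfun).
pose G : {mfun R >-> (R * R)%type} := mfun_Sub (mem_set mG : _ \in mfun).
exists (distribution mu p : probability R R).
  apply: finite_support_in_Pk.
  change (mu (nearest y0 ys @^-1` (~` [set x | x \in ys'])) = 0%E).
  rewrite (_ : _ @^-1` _ = set0) ?measure0//.
  by apply/seteqP; split => x //=; apply; exact: nearest_in.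
apply: ereal_inf_lbound; exists (distribution mu G : probability (R * R)%type R).
  split => A mA.
    change (mu (G @^-1` (A `*` setT)) = mu A).
    by congr (mu _); apply/seteqP; split => x //= -[].
  change (mu (G @^-1` (setT `*` A)) = mu (nearest y0 ys @^-1` A)).
  by congr (mu _); apply/seteqP; split => x //= -[].
rewrite ge0_integral_distribution//.
- by apply: eq_integral => x _ /=; rewrite nearest_dist.
- by apply/measurable_EFinP; exact: measurable_dist2.
Qed.

(** One inequality holds for every law with these atoms; the other compares [nu] with the projection
    of [mu] onto its own atoms. *)
Lemma W1_opt_qcost k mu nu (y w : 'I_k -> R) : (0 < k)%N -> W1_opt k mu nu ->
  is_discrete_k nu y w -> W1 mu nu = qcost mu (map y (enum 'I_k)).
Proof.
move=> k0 [_ nuopt] nud; apply/eqP; rewrite eq_le (qcost_le_W1 _ k0 nud) andbT.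
have sz : size (map y (enum 'I_k)) = k by rewrite size_map size_enum_ord.
have [|lam lamk lamle] := @W1_le_qcost mu (map y (enum 'I_k)).
  by rewrite -size_eq0 sz -lt0n.
by apply: le_trans lamle; apply: nuopt; rewrite -sz.
Qed.

Lemma W1_opt_qcost_le k mu nu (y w : 'I_k -> R) zs : (0 < k)%N -> W1_opt k mu nu ->
  is_discrete_k nu y w -> size zs = k ->
  (qcost mu (map y (enum 'I_k)) <= qcost mu zs)%E.
Proof.
move=> k0 nuopt nud zk; rewrite -(W1_opt_qcost k0 nuopt nud).
have [|lam lamk lamle] := @W1_le_qcost mu zs; first by rewrite -size_eq0 zk -lt0n.
by apply: le_trans lamle; apply: nuopt.2; rewrite -zk.
Qed.

End OptimalQuantizer.

(** * The cumulative distribution function *)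

Section Cdf.
Context (R : realType) (mu : probability R R).
Local Notation F := (cdfmu mu).

Lemma cdfmu_ge0 x : 0 <= F x.
Proof. by rewrite fine_ge0. Qed.

Lemma cdfmu_le1 x : F x <= 1.
Proof.
by rewrite -lee_fin fineK ?fin_num_measure//; exact: probability_le1.
Qed.

Lemma cdfmuD s t : s <= t -> F t = F s + fine (mu `]s, t]%classic).
Proof.
move=> st; rewrite /cdfmu (@itv_bndbnd_setU _ _ -oo%O (BRight s))//.
rewrite measureU//; first by rewrite fineD// fin_num_measure.
apply/seteqP; split => x //= -[]; rewrite !in_itv/= => xs /andP[sx _].
by move: (le_lt_trans xs sx); rewrite ltxx.
Qed.

Lemma cdfmu_le s t : s <= t -> F s <= F t.
Proof. by move=> /cdfmuD->; rewrite lerDl fine_ge0. Qed.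

End Cdf.

(** * The support carries the whole mass *)

Section SupportNull.
Context (R : realType) (mu : probability R R).

(* Lindelöf: the complement of the support is covered by the countably many
   null intervals with rational endpoints. *)
Lemma spt_setC_negligible : mu.-negligible (~` spt mu).
Proof.
pose I (n : nat) : set R := if unpickle n is Some (p, q) then
  [set` `](ratr p : R), (ratr q : R)[] else set0.
pose J n := if mu (I n) == 0%E then I n else set0.
have mI n : measurable (I n).
  by rewrite /I; case: unpickle => [[p q]|].
apply: (@negligibleS _ _ _ mu (\bigcup_n J n)); last first.
  apply: negligible_bigcup => n; exists (J n); split => //.
    by rewrite /J; case: ifP.
  by rewrite /J; case: ifP => [/eqP//|]; rewrite measure0.
move=> x /existsNP[U /not_implyP[oU /not_implyP[Ux /negP]]].
rewrite -leNgt => muU.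
have /nbhs_ballP[e /= e0 eU] := open_nbhs_nbhs (conj oU Ux).
have [|p] := @rat_in_itvoo R (x - e) x; first by rewrite ltrBlDr ltrDl.
have [|q] := @rat_in_itvoo R x (x + e); first by rewrite ltrDl.
rewrite !in_itv/= => /andP[xq qe] /andP[ep px].
exists (pickle (p, q)) => //; rewrite /J.
have IE : I (pickle (p, q)) = [set` `](ratr p : R), (ratr q : R)[].
  by rewrite /I pickleK.
suff -> : mu (I (pickle (p, q))) = 0%E.
  by rewrite eqxx IE /= in_itv/= px xq.
have sub : I (pickle (p, q)) `<=` U.
  rewrite IE => z /=; rewrite in_itv/= => /andP[pz zq]; apply: eU.
  rewrite /ball/=; rewrite ltr_distl; apply/andP; split; lra.
apply/eqP; rewrite -measure_le0; apply: le_trans muU.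
by apply: le_measure => //; rewrite inE//; exact: open_measurable.
Qed.

End SupportNull.

(** * Consequences of the standing assumptions *)

Section Standing.
Context (R : realType).

(** What the later sections retain of the standing assumptions. The last clause is linear growth of
    the c.d.f. around [q], with a slope depending on [q]; it stops short of [a] and [b], where the
    density may vanish. *)
Definition regular_law (mu : probability R R) (a b : R) :=
  [/\ a < b, mu (~` [set` `[a, b]]) = 0%E,
      (forall s t, a <= s -> s < t -> t <= b -> cdfmu mu s < cdfmu mu t),
      (forall v, 0 <= v <= 1 -> exists2 q, a <= q <= b & cdfmu mu q = v) &
      (forall q, a < q < b -> exists2 m, 0 < m &
         forall t, a <= t <= b -> m * `|t - q| <= `|cdfmu mu t - cdfmu mu q|)].

Lemma regular_law_cdf0 mu a b : regular_law mu a b -> cdfmu mu a = 0.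
Proof.
move=> [_ _ _ sF _]; have [|q /andP[aq _] Fq] := sF 0; first by rewrite lexx ler01.
by apply/eqP; rewrite eq_le cdfmu_ge0 andbT -Fq cdfmu_le.
Qed.

Lemma regular_law_cdf1 mu a b : regular_law mu a b -> cdfmu mu b = 1.
Proof.
move=> [_ _ _ sF _]; have [|q /andP[_ qb] Fq] := sF 1; first by rewrite lexx ler01.
by apply/eqP; rewrite eq_le cdfmu_le1 -Fq cdfmu_le.
Qed.

Lemma standing_set1 (mu : probability R R) x : standing mu -> mu [set x] = 0%E.
Proof. by move=> [rho [_ [_ [muE _]]]]; rewrite muE// integral_set1. Qed.

(** Near [q] the difference quotient is bounded by [K], so within distance [e] the density loses at
    most half of its value at [q]. *)
Lemma locally_lower_bounded (rho : R -> R) (a b q l : R) : a < q < b ->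
  0 < rho q ->
  ((fun y => (rho y - rho q) / (y - q)) @
            within [set y | y \in `[a, b] /\ y != q] (nbhs q)) --> l ->
  exists2 e, 0 < e & a <= q - e /\ q + e <= b /\
    forall t, `|t - q| < e -> rho q / 2 <= rho t.
Proof.
move=> /andP[aq qb] rq /cvgrPdist_lt/(_ 1 ltr01).
rewrite near_withinE => /nbhs_ballP[e0 /= e00 H].
set K := `|l| + 1; have K0 : 0 < K by rewrite /K ltr_wpDl.
(* [e0] is the radius where the quotient is controlled, the next two terms keep the interval inside
   [[a, b]], and the last one gives [K * e <= rho q / 2]. *)
pose e := Num.min e0 (Num.min (Num.min (q - a) (b - q)) (rho q / 2 / K)).
have e_gt0 : 0 < e.
  by rewrite !lt_min e00 !subr_gt0 aq qb/= !divr_gt0.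
have ee0 : e <= e0 by rewrite ge_min lexx.
have ea : e <= q - a by rewrite !ge_min lexx !orbT.
have eb : e <= b - q by rewrite !ge_min lexx !orbT.
have eK : e <= rho q / 2 / K by rewrite !ge_min lexx !orbT.
exists e => //; split; first by lra.
split; first by lra.
move=> t te; have [->|tq] := eqVneq t q; first by lra.
have tb : ball q e0 t by rewrite /ball/= distrC (lt_le_trans te).
have : `|l - (rho t - rho q) / (t - q)| < 1.
  apply: H => //=; split => //; rewrite in_itv/=.
  by move: te; rewrite ltr_distl => /andP[? ?]; apply/andP; split; lra.
move=> lt1; have : `|(rho t - rho q) / (t - q)| <= K.
  rewrite /K; have := ler_distD l ((rho t - rho q) / (t - q)) 0.
  rewrite !subr0 => /le_trans; apply; rewrite addrC lerD2l distrC; exact: ltW.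
rewrite normrM normfV ler_pdivrMr ?normr_gt0 ?subr_eq0// => le2.
have : `|rho t - rho q| <= rho q / 2.
  apply: (le_trans le2); rewrite -ler_pdivlMl// mulrC.
  by rewrite (le_trans (ltW te)).
by rewrite ler_distl => /andP[? _]; lra.
Qed.

Lemma standing_regular (mu : probability R R) :
  standing mu -> exists a b, regular_law mu a b.
Proof.
move=> st; have mu1 x := standing_set1 x st.
case: st => rho [mrho [rho0 [muE [a [b [ab [sptE [rhogt0 drho]]]]]]]].
exists a, b.
have muC : mu (~` [set` `[a, b]]) = 0%E.
  have : mu.-negligible (~` [set` `[a, b]]).
    by rewrite -sptE; exact: spt_setC_negligible.
  by move=> /negligibleP -> //; exact: measurableC.
have muab : mu [set` `[a, b]] = 1%E.
  have := @probability_setT _ _ _ mu.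
  rewrite -(setUv [set` `[a, b]]) measureU//; last by rewrite setICr.
    by rewrite /= muC adde0.
  exact: measurableC.
have Fm s t : a <= s -> s < t -> t <= b -> cdfmu mu s < cdfmu mu t.
  move=> as_ s_t tb; rewrite (cdfmuD mu (ltW s_t)) ltrDl fine_gt0//.
  rewrite ltey_eq fin_num_measure// andbT.
  (* The midpoint is in the support, so the open interval around it has positive mass. *)
  have xs : spt mu ((s + t) / 2) by rewrite sptE/= in_itv/=; apply/andP; split; lra.
  apply: lt_le_trans (xs `]s, t[%classic (interval_open _ _) _) _ => //.
    by rewrite /= in_itv/=; apply/andP; split; lra.
  apply: le_measure; rewrite ?inE//.
  by move=> z /=; rewrite !in_itv/= => /andP[-> /ltW].
have Fa : cdfmu mu a = 0.
  rewrite /cdfmu (_ : mu _ = 0%E)//.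
  have -> : `]-oo, a]%classic = `]-oo, a[%classic `|` [set a].
    by rewrite setUitv1.
  apply/eqP; rewrite -measure_le0.
  apply: (@le_trans _ _ (mu `]-oo, a[%classic + mu [set a])%E).
    exact: measureU2.
  rewrite mu1 adde0 -muC; apply: le_measure; rewrite ?inE//.
    exact: measurableC.
  by move=> x /=; rewrite !in_itv/= => xa /andP[ax _]; move: (le_lt_trans ax xa); rewrite ltxx.
have mux x : a <= x -> cdfmu mu x = \int[lebesgue_measure]_(t in `[a, x]) rho t.
  move=> ax; rewrite (cdfmuD mu ax) Fa add0r /Rintegral -muE//; congr fine.
  have -> : `[a, x]%classic = [set a] `|` `]a, x]%classic by rewrite setU1itv.
  rewrite measureU//.
    by rewrite /= mu1 add0e.
  by apply/seteqP; split=> z //= -[->]; rewrite in_itv/= ltxx.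
have Fb : cdfmu mu b = 1.
  rewrite mux ?(ltW ab)// /Rintegral -muE// muab//.
split => //.
- move=> v v01.
  have irho : lebesgue_measure.-integrable `[a, b] (EFin \o rho).
    apply/integrableP; split; first exact/measurable_EFinP/measurable_funTS.
    under eq_integral do rewrite /= ger0_norm//.
    by rewrite -muE// muab ltry.
  have c := parameterized_integral_continuous (ltW ab) irho.
  have [|q] := @IVT _ _ _ _ v (ltW ab) c.
    rewrite /parameterized_integral/= -!mux ?(ltW ab)// Fa Fb.
    by rewrite min_l ?max_r.
  rewrite in_itv/= => qab; rewrite /parameterized_integral/= -mux; last by case/andP: qab.
  by move=> Fq; exists q.
- move=> q qab; have /andP[aq qb] := qab.
  have [|l rl] := drho q; first by rewrite in_itv/= !ltW.
  have rq := rhogt0 _ qab.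
  have [e e0 [ea [eb er]]] := locally_lower_bounded qab rq rl.
  have dens s t : q - e < s -> s <= t -> t < q + e ->
      rho q / 2 * (t - s) <= cdfmu mu t - cdfmu mu s.
    move=> qs s_t tq; rewrite (cdfmuD mu s_t) [leRHS]addrAC subrr add0r.
    rewrite -lee_fin fineK ?fin_num_measure// muE//.
    have -> : (rho q / 2 * (t - s))%:E =
       (\int[lebesgue_measure]_(x in `]s, t]) (cst (rho q / 2)%:E x))%E.
      rewrite integral_cst//= lebesgue_measure_itv/= lte_fin.
      have [st'|ts] := ltP s t; first by rewrite EFinM EFinB.
      have -> : s = t by apply/eqP; rewrite eq_le s_t.
      by rewrite subrr mulr0 mule0.
    apply: ge0_le_integral => //.
    + by move=> x _; rewrite lee_fin divr_ge0// ltW.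
    + exact/measurable_EFinP/measurable_funTS.
    + move=> x /=; rewrite in_itv/= => /andP[sx xt]; rewrite lee_fin; apply: er.
      by rewrite ltr_distl; apply/andP; split; lra.
  set m0 := rho q / 2 in dens *.
  have m00 : 0 < m0 by rewrite divr_gt0.
  (* The slope [m0] is used only within [e / 2] of [q]. Farther away monotonicity preserves the gain
     [m0 * (e / 2)], and spreading it over the length [b - a] gives a linear bound on all of
     [[a, b]]. *)
  exists (m0 * ((e / 2) / (b - a))).
    by rewrite mulr_gt0// !divr_gt0// subr_gt0.
  have ba0 : 0 < b - a by rewrite subr_gt0.
  have eba : e / 2 / (b - a) <= 1 by rewrite ler_pdivrMr// mul1r; lra.
  move=> t /andP[at_ tb].
  suff dd (u : R) : 0 <= u -> u <= b - a -> e / 2 / (b - a) * u <= Num.min u (e / 2).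
    have [qt|tq] := leP q t.
      rewrite !ger0_norm ?subr_ge0 ?cdfmu_le//.
      have /(ler_wpM2l (ltW m00)) : e / 2 / (b - a) * (t - q) <= Num.min (t - q) (e / 2).
        by apply: dd; lra.
      rewrite mulrA => /le_trans; apply.
      have [te|te] := leP (t - q) (e / 2); first by apply: dens; lra.
      have -> : e / 2 = (q + e / 2) - q by lra.
      apply: le_trans (dens _ _ _ _ _) _; rewrite ?lerB// ?cdfmu_le//; lra.
    rewrite !ltr0_norm ?subr_lt0//; last by apply: Fm => //; exact: ltW.
    rewrite !opprB.
    have /(ler_wpM2l (ltW m00)) : e / 2 / (b - a) * (q - t) <= Num.min (q - t) (e / 2).
      by apply: dd; lra.
    rewrite mulrA => /le_trans; apply.
    have [te|te] := leP (q - t) (e / 2); first by apply: dens; lra.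
    have -> : e / 2 = q - (q - e / 2) by lra.
    apply: le_trans (dens _ _ _ _ _) _; rewrite ?lerB// ?cdfmu_le//; lra.
  move=> u0 uba; rewrite le_min; apply/andP; split.
    by rewrite -[leRHS]mul1r ler_wpM2r.
  by rewrite mulrAC ler_pdivrMr// ler_wpM2l// divr_ge0// ltW.
Qed.

End Standing.

(** * Couplings, essential displacement and shifted quantiles *)

Section CouplingBounds.
Context (R : realType).
Implicit Types (mu nu mut nut : probability R R) (pi : probability (R * R)%type R).

(** [pi (far w) = 0] means that [pi] almost surely moves mass by at most [w], the constraint in
    [Winf]. *)
Definition far (w : R) : set (R * R) := [set z | w < `|z.1 - z.2|].

Lemma measurable_far w : measurable (far w).
Proof.
have := @measurable_dist2 R measurableT `]w, +oo[%classic (measurable_itv _).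
by rewrite setTI; congr measurable; apply/seteqP; split => z /=; rewrite in_itv/= andbT.
Qed.

Lemma coupling_far1 mu mut pi w (A B : set R) : coupling mu mut pi ->
  pi (far w) = 0%E -> measurable A -> measurable B ->
  (forall x x', `|x - x'| <= w -> A x -> B x') -> (mu A <= mut B)%E.
Proof.
move=> [pi1 pi2] piw mA mB AB; rewrite -pi1// -pi2//.
have mAT : measurable (A `*` [set: R]) by exact: measurableX.
have mTB : measurable ([set: R] `*` B) by exact: measurableX.
have mf := measurable_far w.
apply: (@le_trans _ _ (pi (([set: R] `*` B) `|` far w))).
  apply: le_measure; rewrite ?inE//; first exact: measurableU.
  move=> -[x x'] [/= Ax _]; have [le|gt] := leP `|x - x'| w; last by right.
  by left; split => //; exact: AB le Ax.
apply: (@le_trans _ _ (pi ([set: R] `*` B) + pi (far w))%E); last by rewrite piw adde0.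
exact: measureU2.
Qed.

Lemma coupling_far2 mu mut pi w (A B : set R) : coupling mu mut pi ->
  pi (far w) = 0%E -> measurable A -> measurable B ->
  (forall x x', `|x - x'| <= w -> B x' -> A x) -> (mut B <= mu A)%E.
Proof.
move=> [pi1 pi2] piw mA mB AB; rewrite -pi1// -pi2//.
have mAT : measurable (A `*` [set: R]) by exact: measurableX.
have mTB : measurable ([set: R] `*` B) by exact: measurableX.
have mf := measurable_far w.
apply: (@le_trans _ _ (pi ((A `*` [set: R]) `|` far w))).
  apply: le_measure; rewrite ?inE//; first exact: measurableU.
  move=> -[x x'] [/= _ Bx]; have [le|gt] := leP `|x - x'| w; last by right.
  by left; split => //; exact: AB le Bx.
apply: (@le_trans _ _ (pi (A `*` [set: R]) + pi (far w))%E); last by rewrite piw adde0.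
exact: measureU2.
Qed.

Lemma far_null_ge0 pi w : pi (far w) = 0%E -> 0 <= w.
Proof.
move=> piw; rewrite leNgt; apply/negP => w0.
have fT : far w = setT by apply/seteqP; split => z //= _; exact: lt_le_trans w0 _.
by move: piw; rewrite fT probability_setT => /eqP; rewrite onee_eq0.
Qed.

Lemma transport_cost_far pi w : pi (far w) = 0%E -> (transport_cost pi <= w%:E)%E.
Proof.
move=> piw; have -> : w%:E = (\int[pi]_z cst w%:E z)%E.
  by rewrite integral_cst//= probability_setT mule1.
apply: (@le_integral_null _ _ _ pi (~` far w)).
- by apply: measurableC; exact: measurable_far.
- by rewrite setCK.
- by move=> z /negP; rewrite -leNgt lee_fin.
Qed.

Lemma W1_le_Winf mu mut : (W1 mu mut <= Winf mu mut)%E.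
Proof.
apply: le_ereal_inf_tmp => _ [w [pi [cpi piw]] <-].
by apply: le_trans (transport_cost_far piw); apply: ereal_inf_lbound; exists pi.
Qed.

Lemma W1_ge0 mu mut : (0 <= W1 mu mut)%E.
Proof. by apply: le_ereal_inf_tmp => _ [pi _ <-]; exact: integral_ge0. Qed.

(** The product coupling moves nothing farther than the length of the common interval. Finiteness
    matters because [fine] would send an infinite value to zero. *)
Lemma Winf_fin_num mu mut (c d : R) :
  mu (~` [set` `[c, d]]) = 0%E -> mut (~` [set` `[c, d]]) = 0%E ->
  Winf mu mut \is a fin_num.
Proof.
move=> muC mutC; rewrite fin_numElt; apply/andP; split.
  exact: lt_le_trans (le_trans (W1_ge0 mu mut) (W1_le_Winf mu mut)).
apply: le_lt_trans (ltry (d - c)).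
apply: ereal_inf_lbound; exists (d - c) => //.
have cpi : coupling mu mut (mu \x mut : probability (R * R)%type R)%E.
  split => A mA.
    change ((mu \x mut)%E (A `*` setT) = mu A).
    by rewrite product_measure1E//= probability_setT mule1.
  change ((mu \x mut)%E (setT `*` A) = mut A).
  by rewrite product_measure1E//= probability_setT mul1e.
exists (mu \x mut : probability (R * R)%type R)%E; split => //.
set pi := (X in X _ = _).
have m1 : measurable (~` [set` `[c, d]]) by exact: measurableC.
have n1 := coupling_null1 cpi m1 muC.
have n2 := coupling_null2 cpi m1 mutC.
have sub : far (d - c) `<=`
    (fst @^-1` (~` [set` `[c, d]]) `|` snd @^-1` (~` [set` `[c, d]])).
  move=> -[x x'] /= xx'; apply: contrapT => /not_orP[/contrapT + /contrapT].
  rewrite !in_itv/= => /andP[? ?] /andP[? ?].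
  by move: xx'; rewrite /far /= ltNge => /negP; apply; rewrite ler_distl; apply/andP; split; lra.
have mf1 : measurable (fst @^-1` (~` [set` `[c, d]]) : set (R * R)).
  by rewrite -[_ @^-1` _]setTI; exact: measurable_fst.
have mf2 : measurable (snd @^-1` (~` [set` `[c, d]]) : set (R * R)).
  by rewrite -[_ @^-1` _]setTI; exact: measurable_snd.
apply: (subset_measure0 (measurable_far _) _ sub); first exact: measurableU.
exact: etrans (measureU0 mf1 mf2 n2) n1.
Qed.

Lemma Winf_ge mu mut (u : \bar R) :
  (forall w pi, coupling mu mut pi -> pi (far w) = 0%E -> (u <= w%:E)%E) ->
  (u <= Winf mu mut)%E.
Proof. by move=> H; apply: le_ereal_inf_tmp => _ [w [pi [cpi piw]] <-]; exact: H cpi piw. Qed.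

(** The coupling gives [F (t - w) <= F q <= F (t + w)] for the c.d.f. of [mu]. Strict monotonicity
    on [[a, b]] turns this into [|q - t| <= w], except that [t] may be too large when [q = b] or too
    small when [q = a]; clipping repairs these two cases. *)
Lemma quantile_shift mu mut pi a b w (q t : R) : regular_law mu a b ->
  coupling mu mut pi -> pi (far w) = 0%E -> a <= q <= b ->
  cdfmu mu q = cdfmu mut t ->
  `|q - Num.max (a - w) (Num.min t (b + w))| <= w.
Proof.
move=> reg cpi piw /andP[aq qb] Fq; have [ab _ Fm _ _] := reg.
have w0 := far_null_ge0 piw.
have le1 : cdfmu mu (t - w) <= cdfmu mu q.
  rewrite Fq; apply: fine_le; rewrite ?fin_num_measure//.
  apply: (coupling_far1 cpi piw) => // x x'; rewrite ler_distl => /andP[? ?].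
  by rewrite /= !in_itv/=; lra.
have le2 : cdfmu mu q <= cdfmu mu (t + w).
  rewrite Fq; apply: fine_le; rewrite ?fin_num_measure//.
  apply: (coupling_far2 cpi piw) => // x x'; rewrite ler_distl => /andP[? ?].
  by rewrite /= !in_itv/=; lra.
have tw1 : t - w <= q \/ q = b.
  have [?|?] := leP (t - w) q; first by left.
  right; apply/eqP; rewrite eq_le qb /= leNgt; apply/negP => qltb.
  have := le1; apply/negP; rewrite -ltNge.
  have [?|?] := leP (t - w) b; first exact: Fm.
  by apply: lt_le_trans (Fm _ _ aq qltb (lexx b)) _; apply: cdfmu_le; exact: ltW.
have tw2 : q <= t + w \/ q = a.
  have [?|?] := leP q (t + w); first by left.
  right; apply/eqP; rewrite eq_le aq andbT leNgt; apply/negP => altq.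
  have := le2; apply/negP; rewrite -ltNge.
  have [?|?] := leP a (t + w); first exact: Fm.
  by apply: le_lt_trans (Fm _ _ (lexx a) altq qb); apply: cdfmu_le; exact: ltW.
rewrite ler_distl.
have [?|?] := leP t (b + w); [have [?|?] := leP (a - w) t|have [?|?] := leP (a - w) (b + w)];
  by apply/andP; split; lra.
Qed.

(** Projecting onto an interval brings a point no farther from any point of that interval. *)
Lemma clip_dist (a b t x : R) : a <= x <= b ->
  `|x - Num.max a (Num.min t b)| <= `|x - t|.
Proof.
move=> /andP[ax xb]; have [tb|bt] := leP t b.
  have [//|ta] := leP a t; rewrite !ger0_norm ?subr_ge0//; first lra.
  by rewrite ltW// (lt_le_trans ta).
have [ab|?] := leP a b; last by lra.
by rewrite distrC [leRHS]distrC !ger0_norm ?subr_ge0//; lra.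
Qed.

(** Five comparisons: clip the [yt j] at cost [w], pass from [mu] to [mut], undo the clipping at no
    cost, replace [yt] by [y] by optimality, and return to [mu]. The couplings [pi] and [pi'] are
    separate so that each can later be optimized for its own distance. *)
Lemma qcost_quantile k mu mut nu nut pi pi' a b w (y yt q wt wt' : 'I_k -> R) :
  (0 < k)%N -> regular_law mu a b ->
  W1_opt k mu nu -> is_discrete_k nu y wt ->
  W1_opt k mut nut -> is_discrete_k nut yt wt' ->
  coupling mu mut pi -> pi (far w) = 0%E -> coupling mu mut pi' ->
  (forall j, a <= q j <= b) -> (forall j, cdfmu mu (q j) = cdfmu mut (yt j)) ->
  (qcost mu (map q (enum 'I_k)) <=
   W1 mu nu + transport_cost pi' + transport_cost pi' + w%:E)%E.
Proof.
move=> k0 reg onu dnu onut dnut cpi piw cpi' qab qF.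
have e0 : enum 'I_k != [::] by rewrite -size_eq0 size_enum_ord -lt0n.
have m0 (f : 'I_k -> R) : map f (enum 'I_k) != [::] by case: (enum _) e0.
have sz (f : 'I_k -> R) : size (map f (enum 'I_k)) = k.
  by rewrite size_map size_enum_ord.
have [ab muC _ _ _] := reg.
pose clip j := Num.max (a - w) (Num.min (yt j) (b + w)).
have step1 : (qcost mu (map q (enum 'I_k)) <=
    qcost mu (map clip (enum 'I_k)) + w%:E)%E.
  have -> : w%:E = (\int[mu]_x cst w%:E x)%E.
    by rewrite integral_cst//= probability_setT mule1.
  rewrite /qcost -ge0_integralD//.
  - apply: (@le_integral_null _ _ _ mu setT) => //; first by rewrite setCT measure0.
    move=> x _; rewrite -EFinD lee_fin; apply: dist_to_map_le => // j _.
    apply: (le_trans (ler_distD (clip j) x (q j))); rewrite lerD2l distrC.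
    exact: quantile_shift reg cpi piw (qab j) (qF j).
  - by move=> x _; rewrite lee_fin dist_to_ge0.
  - by apply/measurable_EFinP; exact: measurable_dist_to.
  - by move=> x _; rewrite lee_fin (far_null_ge0 piw).
have step2 := qcost_coupling1 cpi' (m0 clip).
(* The displacement bound confines [mut] to [[a - w, b + w]], the interval used for clipping. *)
have step3 : (qcost mut (map clip (enum 'I_k)) <= qcost mut (map yt (enum 'I_k)))%E.
  apply: (@le_integral_null _ _ _ mut [set` `[a - w, b + w]]) => //.
    apply/eqP; rewrite -measure_le0 -muC.
    apply: (coupling_far2 cpi piw); [exact: measurableC|exact: measurableC|].
    move=> x x' xx'; apply: contra_not; rewrite /= !in_itv/= => /andP[? ?].
    by move: xx'; rewrite ler_distl => /andP[? ?]; apply/andP; split; lra.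
  move=> x /= xab; rewrite lee_fin -[leRHS]addr0; apply: dist_to_map_le => // j _.
  by rewrite addr0; apply: clip_dist; move: xab; rewrite in_itv.
have step4 := W1_opt_qcost_le k0 onut dnut (sz y).
have step5 := qcost_coupling2 cpi' (m0 y).
rewrite (W1_opt_qcost k0 onu dnu).
apply: (le_trans step1); rewrite leeD2r//.
apply: (le_trans step2); rewrite leeD2r//.
exact: le_trans step3 (le_trans step4 step5).
Qed.

End CouplingBounds.

(** * Second moments of the empirical c.d.f *)

Section EmpiricalDeviation.
Context (R : realType) (mu : probability R R).

Lemma iid_mean_ext n (f g : seq R -> R) m : (forall s, size s = n -> f s = g s) ->
  iid_mean mu n f m -> iid_mean mu n g m.
Proof.
elim: n f g m => [|n IH] f g m fg /=; first by rewrite fg.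
move=> [G [iG fG EG]]; exists G; split => // x.
by apply: IH (fG x) => s sn; apply: fg; rewrite /= sn.
Qed.

(** The exact mean is kept as a witness so that an error [e] can also be subtracted: lower bounds
    use the mean of [-1 * e]. *)
Definition mean_le n (e : seq R -> R) (B : R) :=
  exists2 m, iid_mean mu n e m & m <= B.

Lemma mean_leW n e B B' : B <= B' -> mean_le n e B -> mean_le n e B'.
Proof. by move=> BB [m em mB]; exists m => //; exact: le_trans BB. Qed.

Lemma mean_le_cst n c : mean_le n (fun=> c) c.
Proof. by exists c => //; exact: iid_mean_cst. Qed.

Lemma mean_leD n e f B C : mean_le n e B -> mean_le n f C ->
  mean_le n (fun s => e s + f s) (B + C).
Proof.
by move=> [m em mB] [p fp pC]; exists (m + p); [exact: iid_meanD|exact: lerD].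
Qed.

Lemma mean_leZ n c e B : 0 <= c -> mean_le n e B ->
  mean_le n (fun s => c * e s) (c * B).
Proof.
by move=> c0 [m em mB]; exists (c * m); [exact: iid_meanZ|exact: ler_wpM2l].
Qed.

Lemma mean_le_sum (I : Type) (r : seq I) n (f : I -> seq R -> R) (B : I -> R) :
  (forall i, mean_le n (f i) (B i)) ->
  mean_le n (fun s => \sum_(i <- r) f i s) (\sum_(i <- r) B i).
Proof.
move=> fB; have /choice[m mP] : forall i, exists m, iid_mean mu n (f i) m /\ m <= B i.
  by move=> i; have [m ? ?] := fB i; exists m.
exists (\sum_(i <- r) m i).
  by apply: iid_mean_sum => i; exact: (mP i).1.
by apply: ler_sum => i _; exact: (mP i).2.
Qed.

Definition centered (t x : R) : R := \1_(`]-oo, t]%classic) x - cdfmu mu t.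

(** For samples of size [n] this is [F_n(t) - F(t)], written as a sum of centered terms so that its
    moments follow from the i.i.d. lemmas. *)
Definition dev n (t : R) (s : seq R) : R := n%:R^-1 * \sum_(x <- s) centered t x.

Lemma measurable_centered t : measurable_fun setT (centered t).
Proof. by apply: measurable_funB => //; exact: measurable_indic. Qed.

Lemma centered_le1 t x : `|centered t x| <= 1.
Proof.
have := cdfmu_ge0 mu t; have := cdfmu_le1 mu t.
rewrite /centered indicE ler_norml; case: (_ \in _) => /= ? ?; apply/andP; split; lra.
Qed.

Lemma integrable_bounded (f : R -> R) (M : R) : measurable_fun setT f ->
  (forall x, `|f x| <= M) -> mu.-integrable setT (EFin \o f).
Proof.
move=> mf fM; apply: measurable_bounded_integrable => //.
  by rewrite (le_lt_trans (probability_le1 _ _))// ltry.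
exists M; split; first by rewrite num_real.
by move=> M' MM' x _ /=; rewrite (le_trans (fM x))// ltW.
Qed.

Lemma integrable_centered t : mu.-integrable setT (EFin \o centered t).
Proof. exact: integrable_bounded (@measurable_centered t) (centered_le1 t). Qed.

Lemma integral_centered t : (\int[mu]_x (centered t x)%:E = 0)%E.
Proof.
have i1 : mu.-integrable setT (EFin \o \1_(`]-oo, t]%classic)).
  apply: (@integrable_bounded _ 1); first exact: measurable_indic.
  by move=> x; rewrite indicE; case: (_ \in _); rewrite ?normr1 ?normr0.
have i2 : mu.-integrable setT (EFin \o cst (- cdfmu mu t)).
  exact: finite_measure_integrable_cst.
rewrite (integralD measurableT i1 i2).
rewrite (_ : EFin \o cst (- cdfmu mu t) = cst (- cdfmu mu t)%:E)// integral_cst//=.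
rewrite probability_setT mule1 integral_indic// setIT.
by rewrite /cdfmu EFinN fineK ?subee// fin_num_measure.
Qed.

Lemma iid_mean_dev n t : iid_mean mu n (dev n t) 0.
Proof.
have := iid_mean_sum_fun n (@integrable_centered t) (integral_centered t).
by move=> /(iid_meanZ (n%:R^-1)); rewrite !mulr0.
Qed.

Lemma mean_le_dev2 n t : (0 < n)%N -> mean_le n (fun s => dev n t s ^+ 2) n%:R^-1.
Proof.
move=> n0; have sq1 x : `|centered t x ^+ 2| <= 1.
  by rewrite normrX expr_le1// centered_le1.
have i2 : mu.-integrable setT (fun x => (centered t x ^+ 2)%:E).
  by apply: (@integrable_bounded (fun x => centered t x ^+ 2) 1) => //;
    apply: measurable_funX; exact: measurable_centered.
set v := (\int[mu]_x (centered t x ^+ 2)%:E)%E.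
have vfin : v \is a fin_num by exact: integrable_fin_num.
have v1 : fine v <= 1.
  rewrite -lee_fin fineK//.
  have -> : 1%E = (\int[mu]_x cst 1%E x)%E.
    by rewrite integral_cst//= probability_setT mule1.
  apply: (@le_integral_null _ _ _ mu setT) => //; first by rewrite setCT measure0.
  by move=> x _; rewrite lee_fin (le_trans (ler_norm _)).
have := @iid_mean_sqr_sum _ mu n (centered t) (fine v) 0 (@integrable_centered t)
  (integral_centered t) i2 (esym (fineK vfin)).
move=> /(iid_meanZ (n%:R^-1 ^+ 2)) H; exists (n%:R^-1 ^+ 2 * (0 ^+ 2 + n%:R * fine v)).
  by apply: iid_mean_ext H => s sn; rewrite /dev exprMn add0r.
rewrite expr0n add0r expr2 -!mulrA mulKf ?pnatr_eq0 -?lt0n//.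
by rewrite ler_piMr ?invr_ge0.
Qed.

Lemma dev_count n t s : size s = n -> (0 < n)%N ->
  dev n t s = (count (fun x => x <= t) s)%:R / n%:R - cdfmu mu t.
Proof.
move=> sn n0; have nn0 : n%:R != 0 :> R by rewrite pnatr_eq0 -lt0n.
have E : \sum_(x <- s) centered t x =
    (count (fun x => x <= t) s)%:R - (size s)%:R * cdfmu mu t.
  elim: s {sn} => [|x s IH] /=; first by rewrite big_nil mul0r subr0.
  rewrite big_cons IH /centered indicE natrD -[in RHS]natr1 mulrDl mul1r.
  have -> : (x \in `]-oo, t]%classic) = (x <= t) by rewrite mem_setE in_itv.
  by case: (x <= t) => /=; ring.
by rewrite /dev E sn; field.
Qed.

End EmpiricalDeviation.

(** * Social cost against its mean, uniformly in the facilities *)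

Section SocialCost.
Context (R : realType) (mu : probability R R) (a b : R).
Hypothesis reg : regular_law mu a b.
Implicit Types (ys : seq R).

Let ab : a < b. Proof. by case: reg. Qed.
Let muC : mu (~` [set` `[a, b]]) = 0%E. Proof. by case: reg. Qed.

Definition sample n (s : seq R) := size s = n /\ forall x, x \in s -> a <= x <= b.

Lemma le_Eiid n f g : (forall s, sample n s -> f s <= g s) ->
  (Eiid mu n f <= Eiid mu n g)%E.
Proof.
move=> fg; apply: (@le_iidE _ mu [set` `[a, b]]) => // s sn sab.
by rewrite lee_fin; apply: fg; split => // x xs; have /= := sab _ xs; rewrite in_itv.
Qed.

Lemma Eiid_le_mean n f e B : (forall s, sample n s -> f s <= e s) ->
  mean_le mu n e B -> (Eiid mu n f <= B%:E)%E.
Proof.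
move=> fe [m em mB]; apply: le_trans (le_Eiid fe) _.
by rewrite (iid_mean_Eiid em) lee_fin.
Qed.

Lemma integrable_dist_to ys : ys != [::] ->
  mu.-integrable setT (fun x => (dist_to x ys)%:E).
Proof.
move=> ys0; have [y yys _] := dist_to_ex a ys0.
apply/integrableP; split.
  by apply/measurable_EFinP; exact: measurable_dist_to.
apply: (@le_lt_trans _ _ (\int[mu]_x cst (b - a + `|a - y|)%:E x)%E); last first.
  by rewrite integral_cst//= probability_setT mule1 ltry.
apply: (@le_integral_null _ _ _ mu [set` `[a, b]]) => // x /=.
rewrite in_itv/= => /andP[ax xb]; rewrite lee_fin ger0_norm ?dist_to_ge0//.
apply: (le_trans (dist_to_le x yys)); apply: (le_trans (ler_distD a x y)).
by rewrite lerD2r ger0_norm ?subr_ge0// lerB.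
Qed.

Lemma qcost_fin_num ys : ys != [::] -> qcost mu ys \is a fin_num.
Proof. by move=> /integrable_dist_to; exact: integrable_fin_num. Qed.

Lemma iid_mean_SC n ys : (0 < n)%N -> ys != [::] ->
  iid_mean mu n (fun s => SC s ys) (fine (qcost mu ys)).
Proof.
move=> n0 ys0.
have := iid_mean_sum_fun n (integrable_dist_to ys0)
  (esym (fineK (qcost_fin_num ys0))).
move=> /(iid_meanZ (n%:R^-1)); rewrite mulKf ?pnatr_eq0 -?lt0n//.
by apply: iid_mean_ext => s sn; rewrite /SC sn.
Qed.

Let T (dl : R) (i : nat) : R := a + i%:R * dl.

(** Summation by parts: for [x] in the grid cell ending at [T dl j] the active increments telescope,
    leaving [dist_to (T dl j) ys]. *)
Let stepf ys dl M x := dist_to (T dl M) ys +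
  \sum_(i < M) (dist_to (T dl i) ys - dist_to (T dl i.+1) ys) *
    \1_(`]-oo, T dl i]%classic) x.

Let stepfP ys dl M x : ys != [::] -> 0 <= dl -> a <= x -> x <= T dl M ->
  `|dist_to x ys - stepf ys dl M x| <= dl.
Proof.
move=> ys0 dl0 ax; rewrite /stepf; elim: M => [|M IH] xT.
  have -> : x = T dl 0.
    by apply/eqP; rewrite eq_le xT /= /T mul0r addr0.
  by rewrite big_ord0 addr0 subrr normr0.
rewrite big_ord_recr /=.
have [xM|Mx] := leP x (T dl M).
  have := IH xM; congr (`|_ - _| <= _).
  rewrite indicE mem_setE in_itv/= xM mulr1; ring.
have -> : \1_(`]-oo, T dl M]%classic) x = 0 :> R.
  by rewrite indicE mem_setE in_itv/= leNgt Mx.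
rewrite big1 => [|i _]; last first.
  rewrite indicE mem_setE in_itv/= leNgt (le_lt_trans _ Mx) ?mulr0//.
  by rewrite /T lerD2l ler_wpM2r// ler_nat ltnW.
rewrite mulr0 !addr0.
have dx : `|x - T dl M.+1| <= dl.
  rewrite distrC ger0_norm ?subr_ge0//.
  by move: Mx; rewrite /T -natr1; lra.
rewrite ler_norml; have := dist_to_lipschitz x (T dl M.+1) ys0.
have := dist_to_lipschitz (T dl M.+1) x ys0; rewrite distrC => l1 l2.
by apply/andP; split; lra.
Qed.

(** Averaging [stepf] over the sample turns each indicator into [F_n = F + dev]. This separates a
    deterministic part from a linear combination of deviations. *)
Let SC_step ys dl M n s : ys != [::] -> 0 <= dl -> b <= T dl M -> (0 < n)%N ->
  sample n s ->
  `|SC s ys - (dist_to (T dl M) ys +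
     \sum_(i < M) (dist_to (T dl i) ys - dist_to (T dl i.+1) ys) * cdfmu mu (T dl i) +
     \sum_(i < M) (dist_to (T dl i) ys - dist_to (T dl i.+1) ys) * dev mu n (T dl i) s)|
  <= dl.
Proof.
move=> ys0 dl0 bT n0 [sn sab]; set c := fun i => dist_to (T dl i) ys - dist_to (T dl i.+1) ys.
have nn0 : n%:R != 0 :> R by rewrite pnatr_eq0 -lt0n.
rewrite -addrA -big_split /=.
have -> : \sum_(i < M) (c i * cdfmu mu (T dl i) + c i * dev mu n (T dl i) s) =
    n%:R^-1 * \sum_(x <- s) \sum_(i < M) c i * \1_(`]-oo, T dl i]%classic) x.
  rewrite exchange_big mulr_sumr; apply: eq_bigr => i _ /=.
  rewrite -mulr_sumr -mulrDr [RHS]mulrCA; congr (_ * _).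
  rewrite /dev /centered big_split /= big_const_seq count_predT sn iter_addr_0.
  by rewrite -[(- _) *+ _]mulr_natl mulrDr mulKf// addrCA subrr addr0.
have -> : dist_to (T dl M) ys = n%:R^-1 * \sum_(x <- s) dist_to (T dl M) ys.
  by rewrite big_const_seq count_predT sn iter_addr_0 -[dist_to _ _ *+ _]mulr_natl mulKf.
rewrite /SC sn -mulrDr -mulrBr -big_split -sumrB normrM normfV (ger0_norm (ler0n _ _)).
rewrite ler_pdivrMl ?ltr0n//.
apply: (le_trans (ler_norm_sum _ _ _)).
have -> : n%:R * dl = \sum_(x <- s) dl.
  by rewrite big_const_seq count_predT sn iter_addr_0 mulr_natl.
rewrite [leLHS]big_seq [leRHS]big_seq; apply: ler_sum => x /sab/andP[ax xb].
by apply: stepfP => //; exact: le_trans bT.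
Qed.

(** Weighted arithmetic-geometric inequality; it reduces first absolute moments to second
    moments. *)
Lemma abs_le_sqr (x h : R) : 0 < h -> `|x| <= h / 2 + (2 * h)^-1 * x ^+ 2.
Proof.
move=> h0; rewrite -real_normK ?num_real//; move: `|x| => z.
rewrite -subr_ge0.
have -> : h / 2 + (2 * h)^-1 * z ^+ 2 - z = (2 * h)^-1 * (z - h) ^+ 2.
  by field; rewrite gt_eqF.
by rewrite mulr_ge0 ?sqr_ge0// invr_ge0 mulr_ge0// ltW.
Qed.

(* Abel summation over a grid of mesh (b - a) / n turns the error uniformly in
   [ys] into a sum of empirical c.d.f. deviations at the grid points. *)
Lemma qcost_le_SC n : (0 < n)%N -> exists2 e,
  mean_le mu n e (3 * (b - a) / Num.sqrt n%:R) &
  forall ys s, ys != [::] -> sample n s -> fine (qcost mu ys) <= SC s ys + e s.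
Proof.
move=> n0; set h := (Num.sqrt n%:R)^-1; set dl := (b - a) / n%:R.
have np : 0 < n%:R :> R by rewrite ltr0n.
have sp : 0 < Num.sqrt n%:R :> R by rewrite sqrtr_gt0.
have h0 : 0 < h by rewrite invr_gt0.
have hh : h ^+ 2 = n%:R^-1 by rewrite exprVn sqr_sqrtr// ltW.
have h1 : h <= 1.
  by rewrite invf_le1// -{1}sqrtr1 ler_wsqrtr// ler1n.
have dl0 : 0 <= dl by apply: divr_ge0; rewrite ?subr_ge0 ltW.
have dlh : dl = (b - a) * h ^+ 2 by rewrite hh.
have Tn : T dl n = b by rewrite /T /dl; field; rewrite gt_eqF.
(* Each increment of the distance over a cell is at most [dl]. Choosing [h = 1 / sqrt n] balances
   the two summands: each kind adds up to [(b - a) * h / 2] in mean. *)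
pose e s := 2 * dl + \sum_(i < n)
   (dl * (h / 2) + dl * (2 * h)^-1 * dev mu n (T dl i) s ^+ 2).
exists e.
  have : mean_le mu n e (2 * dl + \sum_(i < n)
      (dl * (h / 2) + dl * (2 * h)^-1 * n%:R^-1)).
    apply: mean_leD; first exact: mean_le_cst.
    apply: mean_le_sum => i; apply: mean_leD; first exact: mean_le_cst.
    apply: mean_leZ; last exact: mean_le_dev2.
    by rewrite mulr_ge0// invr_ge0 mulr_ge0// ltW.
  apply: mean_leW; rewrite big_const_ord iter_addr_0 -[_ *+ n]mulr_natl mulrDr.
  have -> : n%:R * (dl * (h / 2)) = (b - a) * h / 2.
    by rewrite /dl; field; rewrite gt_eqF.
  have -> : n%:R * (dl * (2 * h)^-1 * n%:R^-1) = (b - a) * h / 2.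
    by rewrite dlh; field; rewrite !gt_eqF.
  rewrite dlh expr2 -/h.
  have : (b - a) * (h * h) <= (b - a) * h.
    by rewrite ler_pM2l ?subr_gt0// ler_piMl// ltW.
  lra.
move=> ys s ys0 ss.
set A := dist_to (T dl n) ys +
  \sum_(i < n) (dist_to (T dl i) ys - dist_to (T dl i.+1) ys) * cdfmu mu (T dl i).
have bT : b <= T dl n by rewrite Tn.
(* The mean cost is the expected cost of a sample of size 1, where the deviations average to
   zero. *)
have up : fine (qcost mu ys) <= A + dl.
  rewrite -lee_fin -(iid_mean_Eiid (iid_mean_SC (ltn0Sn 0) ys0)).
  apply: (@Eiid_le_mean 1 _ (fun s => (A + dl) + \sum_(i < n)
    (dist_to (T dl i) ys - dist_to (T dl i.+1) ys) * dev mu 1 (T dl i) s)).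
    move=> s1 ss1; have := SC_step ys0 dl0 bT (ltn0Sn 0) ss1.
    by rewrite ler_distl -/A => /andP[_ ?]; lra.
  exists (A + dl + \sum_(i < n) 0); last by rewrite big1 ?addr0.
  apply: iid_meanD; first exact: iid_mean_cst.
  apply: iid_mean_sum => i; rewrite -[X in iid_mean _ _ _ X](mulr0
    (dist_to (T dl i) ys - dist_to (T dl i.+1) ys)).
  exact/iid_meanZ/iid_mean_dev.
have := SC_step ys0 dl0 bT n0 ss; rewrite ler_distl -/A => /andP[lo _].
suff : - \sum_(i < n) (dist_to (T dl i) ys - dist_to (T dl i.+1) ys) *
    dev mu n (T dl i) s <= e s - 2 * dl by lra.
rewrite /e addrAC subrr add0r -sumrN; apply: ler_sum => i _.
apply: (le_trans (ler_norm _)); rewrite normrN normrM.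
apply: (@le_trans _ _ (dl * `|dev mu n (T dl i) s|)).
  apply: ler_wpM2r => //; rewrite ler_norml.
  have dd : `|T dl i - T dl i.+1| <= dl.
    rewrite distrC ger0_norm /T -natr1 ?subr_ge0; last by lra.
    by lra.
  have := dist_to_lipschitz (T dl i) (T dl i.+1) ys0.
  have := dist_to_lipschitz (T dl i.+1) (T dl i) ys0.
  by rewrite [`|T dl i.+1 - _|]distrC => ? ?; apply/andP; split; lra.
by rewrite -mulrA -mulrDr ler_wpM2l// abs_le_sqr.
Qed.

End SocialCost.

(** * Order statistics near the quantiles *)

Section OrderStatistic.
Context (R : realType) (mu : probability R R) (a b : R).
Hypothesis reg : regular_law mu a b.
Local Notation F := (cdfmu mu).
Local Notation sample := (sample a b).

Let ab : a < b. Proof. by case: reg. Qed.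

Definition ostat (v : R) (s : seq R) : R :=
  nth 0 (sort <=%R s) `|Num.floor (((size s)%:R - 1) * v)|%N.

Lemma PM_ostat v s : PM v s = [seq ostat vj s | vj <- v].
Proof. by []. Qed.

Let rank n (v : R) := `|Num.floor ((n%:R - 1) * v)|%N.

(** Since [v <= 1], the 0-based rank is at most [n - 1], so the default value of [nth] never
    appears. *)
Lemma rankP n (v : R) : (0 < n)%N -> 0 <= v <= 1 ->
  [/\ (rank n v)%:R <= (n%:R - 1) * v, (n%:R - 1) * v < (rank n v).+1%:R
    & (rank n v < n)%N].
Proof.
move=> n0 /andP[v0 v1].
have n1 : 0 <= n%:R - 1 :> R by rewrite subr_ge0 ler1n.
have z0 : 0 <= (n%:R - 1) * v by rewrite mulr_ge0.
have f0 : (0 <= Num.floor ((n%:R - 1) * v))%R by rewrite floor_ge0.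
have rE : (rank n v)%:R = (Num.floor ((n%:R - 1) * v))%:~R :> R.
  by rewrite /rank natr_absz ger0_norm.
have r1 : (rank n v)%:R <= (n%:R - 1) * v by rewrite rE ge_floor.
split => //.
  by rewrite -natr1 rE; have := floorD1_gt ((n%:R - 1) * v); rewrite intrD.
have : (rank n v)%:R < n%:R :> R.
  apply: (le_lt_trans r1); apply: (@le_lt_trans _ _ (n%:R - 1)).
    by rewrite ler_piMr.
  by rewrite ltrBlDr ltrDl.
by rewrite ltr_nat.
Qed.

Lemma ostat_in n (v : R) s : sample n s -> (0 < n)%N -> 0 <= v <= 1 -> ostat v s \in s.
Proof.
move=> [sn _] n0 v01; have [_ _ rn] := rankP n0 v01.
by rewrite /ostat sn -(mem_sort <=%R) mem_nth// size_sort sn.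
Qed.

Let sorted_s (s : seq R) : sorted <=%R (sort <=%R s).
Proof. exact: sort_le_sorted. Qed.

(** When the percentile exceeds [t], at most [rank n v] reports are [<= t], hence [F_n(t) <= v]. *)
Lemma ostat_gt n (v : R) s t : sample n s -> (0 < n)%N -> 0 <= v <= 1 ->
  t < ostat v s -> F t - v <= - dev mu n t s.
Proof.
move=> [sn _] n0 v01; have [r1 r2 rn] := rankP n0 v01.
rewrite /ostat sn -/(rank n v) => tX.
have np : 0 < n%:R :> R by rewrite ltr0n.
have : (count (fun x => (x <= t)%R) s <= rank n v)%N.
  rewrite leqNgt -(count_sort <=%R); apply/negP => cr.
  have := nth_count_le 0 (sorted_s s) cr; rewrite leNgt => /negP; exact.
rewrite (dev_count _ _ sn n0) opprB lerD2l lerN2 -(ler_nat R) => cr.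
rewrite ler_pdivrMr// (le_trans cr)// (le_trans r1)// mulrC ler_wpM2l//.
  by case/andP: v01.
by rewrite gerBl.
Qed.

(** At least [rank n v + 1] reports are [<= t], and this exceeds [(n - 1) * v]. Dividing by [n]
    instead of [n - 1] costs the extra [1 / n]. *)
Lemma ostat_le n (v : R) s t : sample n s -> (0 < n)%N -> 0 <= v <= 1 ->
  ostat v s <= t -> v - n%:R^-1 - F t <= dev mu n t s.
Proof.
move=> [sn _] n0 v01; have [r1 r2 rn] := rankP n0 v01.
rewrite /ostat sn -/(rank n v) => Xt.
have np : 0 < n%:R :> R by rewrite ltr0n.
have : (rank n v < count (fun x => (x <= t)%R) s)%N.
  rewrite ltnNge -(count_sort <=%R); apply/negP => cr.
  have := @nth_count_gt _ _ t 0 _ (rank n v) (sorted_s s).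
  by rewrite size_sort sn cr rn => /(_ isT); rewrite ltNge Xt.
rewrite (dev_count _ _ sn n0) -(ler_nat R) => cr.
rewrite lerD2r ler_pdivlMr//; apply: le_trans cr; apply: le_trans (ltW r2).
rewrite mulrBl mulVf ?gt_eqF// mulrBl mul1r mulrC lerD2l lerN2.
by case/andP: v01.
Qed.

Let sqr_div_ge1 (x g : R) : 0 < g -> g <= `|x| -> 1 <= (g ^+ 2)^-1 * x ^+ 2.
Proof.
move=> g0 gx; rewrite mulrC ler_pdivlMr ?exprn_gt0// mul1r -[leRHS]real_normK ?num_real//.
by rewrite lerXn2r// nnegrE// ltW.
Qed.

(** Chebyshev in pointwise form: the indicator of a bad event is dominated by a multiple of the
    squared deviation. *)
Lemma ostat_gt_dev n (v : R) s t g : sample n s -> (0 < n)%N -> 0 <= v <= 1 ->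
  0 < g -> g <= F t - v -> t < ostat v s -> 1 <= (g ^+ 2)^-1 * dev mu n t s ^+ 2.
Proof.
move=> ss n0 v01 g0 gF tX; apply: sqr_div_ge1 => //.
apply: (le_trans gF); apply: (le_trans (ostat_gt ss n0 v01 tX)).
by rewrite -normrN ler_norm.
Qed.

Lemma ostat_le_dev n (v : R) s t g : sample n s -> (0 < n)%N -> 0 <= v <= 1 ->
  0 < g -> g <= v - n%:R^-1 - F t -> ostat v s <= t ->
  1 <= (g ^+ 2)^-1 * dev mu n t s ^+ 2.
Proof.
move=> ss n0 v01 g0 gF tX; apply: sqr_div_ge1 => //.
apply: (le_trans gF); apply: (le_trans (ostat_le ss n0 v01 tX)).
exact: ler_norm.
Qed.

Let F01 q : 0 <= F q <= 1.
Proof. by rewrite cdfmu_ge0 cdfmu_le1. Qed.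

Lemma invn_small (e : R) : 0 < e -> exists N, forall n, (N <= n)%N ->
  (0 < n)%N /\ n%:R^-1 <= e.
Proof.
move=> e0; exists (Num.truncn e^-1).+1 => n Nn; split; first exact: leq_trans Nn.
rewrite invf_ple ?posrE ?ltr0n//; last exact: leq_trans Nn.
apply: ltW; apply: lt_le_trans (truncnS_gt _) _.
by rewrite ler_nat.
Qed.

(** Strict monotonicity of the c.d.f. is the input, so the endpoints are covered. Leaving the
    [et]-neighbourhood of [q] costs at most [b - a] and forces a fixed deviation. *)
Lemma ostat_consistent q (e0 : R) : a <= q <= b -> 0 < e0 ->
  exists N, forall n, (N <= n)%N -> (0 < n)%N /\ exists e, [/\ mean_le mu n e e0,
    forall s, 0 <= e s & forall s, sample n s -> `|ostat (F q) s - q| <= e s].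
Proof.
move=> /andP[aq qb] e00; have [_ _ Fm _ _] := reg.
pose et := e0 / 2; have et0 : 0 < et by rewrite divr_gt0.
have ba0 : 0 < b - a by rewrite subr_gt0.
have [K1 K10 up] : exists2 K, 0 <= K & forall n s, (0 < n)%N -> sample n s ->
    ostat (F q) s - q <= et + K * dev mu n (q + et) s ^+ 2.
  (* If [q + et] is beyond [b], no report can overshoot by more than [et]. *)
  have [qe|qe] := leP (q + et) b; last first.
    exists 0 => // n s n0 ss; rewrite mul0r addr0.
    by have /andP[_ ?] := ss.2 _ (ostat_in ss n0 (F01 q)); lra.
  pose g := F (q + et) - F q.
  have g0 : 0 < g by rewrite subr_gt0; apply: Fm => //; rewrite ltrDl.
  exists ((b - a) * (g ^+ 2)^-1); first by rewrite mulr_ge0 ?invr_ge0 ?sqr_ge0// ltW.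
  move=> n s n0 ss; have [?|lt] := leP (ostat (F q) s) (q + et).
    have : 0 <= (b - a) * (g ^+ 2)^-1 * dev mu n (q + et) s ^+ 2.
      by rewrite mulr_ge0 ?sqr_ge0// mulr_ge0 ?invr_ge0 ?sqr_ge0// ltW.
    by lra.
  have /andP[_ Xb] := ss.2 _ (ostat_in ss n0 (F01 q)).
  have := ostat_gt_dev ss n0 (F01 q) g0 (lexx _) lt.
  by move=> /(ler_wpM2l (ltW ba0)); rewrite mulr1 mulrA; lra.
have [K2 K20 [N2 lo]] : exists2 K, 0 <= K & exists N, forall n s, (N <= n)%N ->
    (0 < n)%N -> sample n s ->
    q - ostat (F q) s <= et + K * dev mu n (q - et) s ^+ 2.
  have [qe|qe] := leP a (q - et); last first.
    exists 0 => //; exists 0%N => n s _ n0 ss; rewrite mul0r addr0.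
    by have /andP[? _] := ss.2 _ (ostat_in ss n0 (F01 q)); lra.
  (* Half of the gap in the c.d.f.; the other half absorbs the [1 / n] of [ostat_le]. *)
  pose g := (F q - F (q - et)) / 2.
  have g0 : 0 < g.
    by rewrite divr_gt0// subr_gt0; apply: Fm => //; rewrite ltrBlDr ltrDl.
  have [N HN] := invn_small g0.
  exists ((b - a) * (g ^+ 2)^-1); first by rewrite mulr_ge0 ?invr_ge0 ?sqr_ge0// ltW.
  exists N => n s Nn n0 ss; have [lt|?] := leP (ostat (F q) s) (q - et); last first.
    have : 0 <= (b - a) * (g ^+ 2)^-1 * dev mu n (q - et) s ^+ 2.
      by rewrite mulr_ge0 ?sqr_ge0// mulr_ge0 ?invr_ge0 ?sqr_ge0// ltW.
    by lra.
  have /andP[aX _] := ss.2 _ (ostat_in ss n0 (F01 q)).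
  have gF : g <= F q - n%:R^-1 - F (q - et).
    by have [_] := HN _ Nn; rewrite /g; lra.
  have := ostat_le_dev ss n0 (F01 q) g0 gF lt.
  by move=> /(ler_wpM2l (ltW ba0)); rewrite mulr1 mulrA; lra.
have [N HN] : exists N, forall n, (N <= n)%N -> (0 < n)%N /\ n%:R^-1 <= et / (K1 + K2 + 1).
  by apply: invn_small; rewrite divr_gt0// ltr_wpDl// addr_ge0.
exists (maxn N N2) => n; rewrite geq_max => /andP[Nn N2n].
have [n0 nle] := HN _ Nn; split => //.
exists (fun s => et + K1 * dev mu n (q + et) s ^+ 2 + K2 * dev mu n (q - et) s ^+ 2).
split.
- have : mean_le mu n (fun s => et + K1 * dev mu n (q + et) s ^+ 2 +
      K2 * dev mu n (q - et) s ^+ 2) (et + K1 * n%:R^-1 + K2 * n%:R^-1).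
    apply: mean_leD; last exact/mean_leZ/mean_le_dev2.
    by apply: mean_leD; [exact: mean_le_cst|exact/mean_leZ/mean_le_dev2].
  apply: mean_leW; have K0 : 0 < K1 + K2 + 1 by rewrite ltr_wpDl// addr_ge0.
  move: nle; rewrite ler_pdivlMr// => nle.
  have : 0 <= n%:R^-1 :> R by rewrite invr_ge0.
  have -> : e0 = et + et by rewrite /et; lra.
  by move=> ?; lra.
- move=> s; have p1 : 0 <= K1 * dev mu n (q + et) s ^+ 2 by rewrite mulr_ge0 ?sqr_ge0.
  have p2 : 0 <= K2 * dev mu n (q - et) s ^+ 2 by rewrite mulr_ge0 ?sqr_ge0.
  by lra.
- move=> s ss; have := up _ _ n0 ss; have := lo _ _ N2n n0 ss => lo' up'.
  have p1 : 0 <= K1 * dev mu n (q + et) s ^+ 2 by rewrite mulr_ge0 ?sqr_ge0.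
  have p2 : 0 <= K2 * dev mu n (q - et) s ^+ 2 by rewrite mulr_ge0 ?sqr_ge0.
  by rewrite ler_norml; apply/andP; split; lra.
Qed.

(** Discrete layer-cake bound: each multiple of [h] strictly below [z] contributes one slice. *)
Lemma staircase (h z : R) M : 0 <= h -> z <= h * M.+1%:R ->
  z <= h + \sum_(i < M) h * (i.+1%:R * h < z)%R%:R.
Proof.
move=> h0; elim: M => [|M IH] zM; first by rewrite big_ord0 addr0 -[h]mulr1.
rewrite big_ord_recr /=; have [zM'|zM'] := leP z (M.+1%:R * h).
  rewrite mulr0 addr0; apply: IH; by rewrite mulrC.
have -> : \sum_(i < M) h * (i.+1%:R * h < z)%R%:R = \sum_(i < M) h.
  apply: eq_bigr => i _; rewrite (le_lt_trans _ zM') ?mulr1//.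
  by rewrite ler_wpM2r// ler_nat ltnS ltnW.
rewrite big_const_ord iter_addr_0 -[h *+ M]mulr_natl.
by rewrite mulr1; move: zM; rewrite -[M.+2%:R]natr1 -[M.+1%:R]natr1; lra.
Qed.

(** The induction proves the sharper bound [2 - 1 / M], using
    [1 / (m + 1)^2 <= 1 / m - 1 / (m + 1)]. *)
Lemma sum_inv_sqr_le2 M : \sum_(i < M) (i.+1%:R ^+ 2)^-1 <= 2 :> R.
Proof.
case: M => [|M]; first by rewrite big_ord0.
suff : \sum_(i < M.+1) (i.+1%:R ^+ 2)^-1 <= 2 - M.+1%:R^-1 :> R.
  by move=> /le_trans; apply; rewrite gerBl invr_ge0.
elim: M => [|M IH].
  by rewrite big_ord_recr big_ord0 /= expr1n invr1 add0r; lra.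
rewrite big_ord_recr /=; apply: le_trans (lerD IH (lexx _)) _.
have m0 : 0 < M.+1%:R :> R by rewrite ltr0n.
rewrite -[M.+2%:R]natr1; move: (M.+1%:R) m0 => m m0.
have m1 : 0 < m + 1 by rewrite addr_gt0.
rewrite -subr_ge0.
have -> : 2 - (m + 1)^-1 - (2 - m^-1 + ((m + 1) ^+ 2)^-1) =
   (m * (m + 1) ^+ 2)^-1 by field; rewrite !gt_eqF.
by rewrite invr_ge0 mulr_ge0 ?sqr_ge0// ltW.
Qed.

(* Splitting |X - q| into slices of width 1/sqrt n, the i-th slice is reached
   only if the empirical c.d.f. deviates by about m i / sqrt n, which has
   probability O(1 / i^2) by Chebyshev. *)
Lemma ostat_rate q : a < q < b ->
  exists C, 0 <= C /\ exists N, forall n, (N <= n)%N -> (0 < n)%N /\ exists e,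
    [/\ mean_le mu n e (C / Num.sqrt n%:R), forall s, 0 <= e s
      & forall s, sample n s -> `|ostat (F q) s - q| <= e s].
Proof.
move=> qab; have /andP[aq qb] := qab; have [_ _ _ _ /(_ _ qab)[m m0 Fm]] := reg.
(* Each side spends [h] on its first slice. The Chebyshev sums add [2 / m ^+ 2] from above and
   [8 / m ^+ 2] from below, the factor 4 being due to the halved gap [g2]. *)
exists (2 + 10 / m ^+ 2); split; first by rewrite addr_ge0// divr_ge0 ?sqr_ge0.
have [N HN] : exists N, forall n, (N <= n)%N -> (0 < n)%N /\ n%:R^-1 <= (m / 2) ^+ 2.
  by apply: invn_small; rewrite exprn_gt0// divr_gt0.
exists N => n Nn; have [n0 nm] := HN _ Nn; split => //.
set h := (Num.sqrt n%:R)^-1.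
have np : 0 < n%:R :> R by rewrite ltr0n.
have sp : 0 < Num.sqrt n%:R :> R by rewrite sqrtr_gt0.
have h0 : 0 < h by rewrite invr_gt0.
have hh : n%:R^-1 = h ^+ 2 by rewrite exprVn sqr_sqrtr// ltW.
have hm : h <= m / 2.
  by move: nm; rewrite hh ler_pXn2r// nnegrE ?divr_ge0 ?(ltW h0) ?(ltW m0).
pose M := Num.truncn ((b - a) / h).
have Mb : b - a <= h * M.+1%:R.
  by rewrite mulrC -ler_pdivrMr// ltW// truncnS_gt.
(* Below [q], half of the gap pays for the [1 / n] in [ostat_le]; this is what [h <= m / 2]
   provides. *)
pose g1 i : R := m * (i.+1%:R * h); pose g2 i := g1 i / 2.
have g10 i : 0 < g1 i by rewrite !mulr_gt0// ltr0n.
have g20 i : 0 < g2 i by rewrite divr_gt0.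
pose u i s := h * ((g1 i ^+ 2)^-1 * dev mu n (q + i.+1%:R * h) s ^+ 2).
pose l i s := h * ((g2 i ^+ 2)^-1 * dev mu n (q - i.+1%:R * h) s ^+ 2).
have u0 i s : 0 <= u i s.
  by apply: mulr_ge0; [exact: ltW|rewrite mulr_ge0 ?invr_ge0 ?sqr_ge0].
have l0 i s : 0 <= l i s.
  by apply: mulr_ge0; [exact: ltW|rewrite mulr_ge0 ?invr_ge0 ?sqr_ge0].
exists (fun s => (h + \sum_(i < M) u i s) + (h + \sum_(i < M) l i s)); split.
- have : mean_le mu n (fun s => (h + \sum_(i < M) u i s) + (h + \sum_(i < M) l i s))
      ((h + \sum_(i < M) h * ((g1 i ^+ 2)^-1 * n%:R^-1)) +
       (h + \sum_(i < M) h * ((g2 i ^+ 2)^-1 * n%:R^-1))).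
    apply: mean_leD; (apply: mean_leD; first exact: mean_le_cst);
      apply: mean_le_sum => i; (apply: mean_leZ; first exact: ltW);
      (apply: mean_leZ; first by rewrite invr_ge0 sqr_ge0); exact: mean_le_dev2.
  apply: mean_leW.
  have E1 : \sum_(i < M) h * ((g1 i ^+ 2)^-1 * n%:R^-1) =
      h / m ^+ 2 * \sum_(i < M) (i.+1%:R ^+ 2)^-1.
    rewrite mulr_sumr; apply: eq_bigr => i _; rewrite hh /g1.
    by field; rewrite !gt_eqF// ltr0n.
  have E2 : \sum_(i < M) h * ((g2 i ^+ 2)^-1 * n%:R^-1) =
      4 * (h / m ^+ 2 * \sum_(i < M) (i.+1%:R ^+ 2)^-1).
    rewrite 2!mulr_sumr; apply: eq_bigr => i _; rewrite hh /g2 /g1.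
    by field; rewrite !gt_eqF// ltr0n.
  have : h / m ^+ 2 * \sum_(i < M) (i.+1%:R ^+ 2)^-1 <= h / m ^+ 2 * 2.
    by apply: ler_wpM2l (sum_inv_sqr_le2 M); rewrite divr_ge0 ?sqr_ge0// ltW.
  rewrite E1 E2 -/h.
  have -> : (2 + 10 / m ^+ 2) * h = 2 * h + 5 * (h / m ^+ 2 * 2).
    by field; rewrite gt_eqF.
  by lra.
- move=> s; have su : 0 <= \sum_(i < M) u i s by rewrite sumr_ge0.
  have sl : 0 <= \sum_(i < M) l i s by rewrite sumr_ge0.
  by lra.
- move=> s ss; have /andP[aX Xb] := ss.2 _ (ostat_in ss n0 (F01 q)).
  set X := ostat (F q) s in aX Xb *.
  have su : 0 <= \sum_(i < M) u i s by rewrite sumr_ge0.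
  have sl : 0 <= \sum_(i < M) l i s by rewrite sumr_ge0.
  have ih0 i : 0 <= i.+1%:R * h by rewrite mulr_ge0// ltW.
  have up : X - q <= h + \sum_(i < M) u i s.
    have := @staircase h (X - q) M (ltW h0); move=> /(_ _)/le_trans; apply; first lra.
    rewrite lerD2l; apply: ler_sum => i _; rewrite ler_wpM2l ?(ltW h0)//.
    case: ltP => [lt|_] /=; last by rewrite mulr_ge0 ?invr_ge0 ?sqr_ge0.
    have tb : a <= q + i.+1%:R * h <= b by have := ih0 i; move=> ?; apply/andP; split; lra.
    apply: (ostat_gt_dev ss n0 (F01 q)) => //; last by rewrite -/X; lra.
    have := Fm _ tb; rewrite addrAC subrr add0r ger0_norm// ger0_norm//.
    by rewrite subr_ge0 cdfmu_le// lerDl.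
  have lo : q - X <= h + \sum_(i < M) l i s.
    have := @staircase h (q - X) M (ltW h0); move=> /(_ _)/le_trans; apply; first lra.
    rewrite lerD2l; apply: ler_sum => i _; rewrite ler_wpM2l ?(ltW h0)//.
    case: ltP => [lt|_] /=; last by rewrite mulr_ge0 ?invr_ge0 ?sqr_ge0.
    have tb : a <= q - i.+1%:R * h <= b by have := ih0 i; move=> ?; apply/andP; split; lra.
    apply: (ostat_le_dev ss n0 (F01 q)) => //; last by rewrite -/X; lra.
    have := Fm _ tb; rewrite distrC opprB addrCA subrr addr0 ger0_norm//.
    rewrite distrC ger0_norm; last by rewrite subr_ge0 cdfmu_le// gerBl.
    have : n%:R^-1 <= g2 i.
      rewrite hh /g2 /g1 expr2.
      have : h * h <= m / 2 * h by rewrite ler_wpM2r// ltW.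
      have : m / 2 * h <= m / 2 * (i.+1%:R * h).
        by rewrite ler_wpM2l ?divr_ge0 ?(ltW m0)// ler_peMl ?ler1n// ltW.
      lra.
    by rewrite /g2 -/(g1 i); lra.
  by rewrite ler_norml; apply/andP; split; lra.
Qed.

(* At an endpoint of the support the percentile is an extreme order statistic,
   which lies between every report and [q]: no loss at all. *)
Lemma ostat_upper_rate q : a <= q <= b ->
  exists C, 0 <= C /\ exists N, forall n, (N <= n)%N -> (0 < n)%N /\ exists e,
    [/\ mean_le mu n e (C / Num.sqrt n%:R), forall s, 0 <= e s
      & forall s, sample n s -> forall x, x \in s ->
          `|x - ostat (F q) s| <= `|x - q| + e s].
Proof.
move=> /andP[aq qb].
have [qa|qa] := eqVneq q a.
  exists 0; split => //; exists 1%N => n n0; split => //; exists (fun=> 0); split => //.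
    by rewrite mul0r; exact: mean_le_cst.
  move=> s ss x xs; rewrite addr0 qa.
  have /andP[ax xb] := ss.2 _ xs.
  have /andP[aX Xb] := ss.2 _ (ostat_in ss n0 (F01 a)).
  suff Xx : ostat (F a) s <= x by rewrite !ger0_norm ?subr_ge0// lerB.
  rewrite /ostat (regular_law_cdf0 reg) mulr0 floor0 /=.
  have : x \in sort <=%R s by rewrite mem_sort.
  move=> /(nthP 0)[i isz <-]; apply: (sorted_leq_nth le_trans lexx 0 (sorted_s s)) => //.
  by rewrite inE; exact: leq_ltn_trans isz.
have [qb'|qb'] := eqVneq q b.
  exists 0; split => //; exists 1%N => n n0; split => //; exists (fun=> 0); split => //.
    by rewrite mul0r; exact: mean_le_cst.
  move=> s ss x xs; rewrite addr0 qb'.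
  have /andP[ax xb] := ss.2 _ xs.
  have /andP[aX Xb] := ss.2 _ (ostat_in ss n0 (F01 b)).
  suff Xx : x <= ostat (F b) s.
    by rewrite distrC [leRHS]distrC !ger0_norm ?subr_ge0// lerB.
  rewrite /ostat (regular_law_cdf1 reg) mulr1 ss.1.
  (* At level 1 the argument of the floor is the integer [n - 1], so the rank is that of the largest
     report. *)
  have -> : n%:R - 1 = (n.-1%:Z)%:~R :> R.
    by rewrite -pmulrn -[in LHS](prednK n0) -natr1 addrK.
  rewrite intrKfloor /=.
  have : x \in sort <=%R s by rewrite mem_sort.
  move=> /(nthP 0)[i isz <-]; apply: (sorted_leq_nth le_trans lexx 0 (sorted_s s)) => //.
    by rewrite inE size_sort ss.1 prednK.
  by rewrite -ltnS prednK// -ss.1 -(size_sort <=%R).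
have [|C [C0 [N HN]]] := @ostat_rate q; first by rewrite !lt_neqAle eq_sym qa aq qb' qb.
exists C; split => //; exists N => n /HN[n0 [e [em e0 eX]]]; split => //.
exists e; split => // s ss x xs; apply: (le_trans (ler_distD q x _)).
by rewrite lerD2l distrC; exact: eX.
Qed.

End OrderStatistic.

(** * Expected costs of the mechanism and of the optimum *)

Section PercentileMechanism.
Context (R : realType).
Implicit Types (mu mut nu nut : probability R R) (ys qs : seq R).

(** With [mut = mu] this coupling makes every error term of [qcost_quantile] vanish, which settles
    the vector [v_mu]. *)
Lemma diagonal_coupling mu :
  exists2 pi, coupling mu mu pi & pi (far 0) = 0%E.
Proof.
have mG : measurable_fun setT (fun x : R => (x, x)) by exact: measurable_fun_pair.
pose G : {mfun R >-> (R * R)%type} := mfun_Sub (mem_set mG : _ \in mfun).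
exists (distribution mu G : probability (R * R)%type R).
  split => A mA.
    change (mu (G @^-1` (A `*` setT)) = mu A).
    by congr (mu _); apply/seteqP; split => x //= -[].
  change (mu (G @^-1` (setT `*` A)) = mu A).
  by congr (mu _); apply/seteqP; split => x //= -[].
change (mu (G @^-1` far 0) = 0%E).
rewrite (_ : _ @^-1` _ = set0) ?measure0//.
by apply/seteqP; split => x //=; rewrite /far /= subrr normr0 ltxx.
Qed.

(** If the mean vanished, the distance would be zero almost everywhere and [mu] would live on the
    finite set [ys], which is null for a law without atoms. *)
Lemma qcost_gt0 mu ys : (forall x, mu [set x] = 0%E) -> ys != [::] ->
  (0 < qcost mu ys)%E.
Proof.
move=> mu1 ys0; rewrite lt_neqAle qcost_ge0 andbT eq_sym; apply/negP => /eqP q0.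
have m1 : mu [set x | x \in ys] = 0%E.
  elim: ys {ys0 q0} => [|y ys IH].
    by rewrite (_ : [set _ | _] = set0) ?measure0//; apply/seteqP; split => x.
  have -> : [set x | x \in y :: ys] = [set y] `|` [set x | x \in ys].
    apply/seteqP; split => x /=; rewrite inE; first by move=> /predU1P[->|xy]; [left|right].
    by move=> [->|->]; rewrite ?eqxx ?orbT.
  exact: etrans (measureU0 (measurable_set1 y) (measurable_mem_seq ys) IH) (mu1 y).
have mf : measurable_fun setT (fun x : R => (dist_to x ys)%:E).
  by apply/measurable_EFinP; exact: measurable_dist_to.
have /(ae_eq_integral_abs _ measurableT mf)[N [mN N0 sN]] :
    (\int[mu]_x `|(dist_to x ys)%:E| = 0)%E.
  rewrite -q0; apply: eq_integral => x _.
  by rewrite gee0_abs// lee_fin dist_to_ge0.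
have NU : mu (N `|` [set x | x \in ys]) = 0%E.
  exact: etrans (measureU0 mN (measurable_mem_seq ys) m1) N0.
have UT : N `|` [set x | x \in ys] = setT.
  apply/seteqP; split => // x _; have [xys|xys] := boolP (x \in ys); first by right.
  left; apply: sN => /= /(_ Logic.I)[] d0; move: xys.
  have [y yys] := dist_to_ex x ys0; rewrite d0 => /esym/eqP.
  by rewrite normr_eq0 subr_eq0 => /eqP ->; rewrite yys.
by move: NU; rewrite UT probability_setT => /eqP; rewrite onee_eq0.
Qed.

Section Law.
Variables (mu : probability R R) (a b : R).
Hypothesis reg : regular_law mu a b.
Local Notation F := (cdfmu mu).
Local Notation sample := (sample a b).

Lemma divsqrt_small (C e : R) : 0 <= C -> 0 < e -> exists N, forall n, (N <= n)%N ->
  (0 < n)%N /\ C / Num.sqrt n%:R <= e.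
Proof.
move=> C0 e0; have ce : 0 < e / (C + 1) by rewrite divr_gt0// ltr_wpDl.
have [N HN] := invn_small (exprn_gt0 2 ce).
exists N => n /HN[n0 nle]; split => //.
have np : 0 < n%:R :> R by rewrite ltr0n.
have : (Num.sqrt n%:R)^-1 <= e / (C + 1).
  rewrite -(@ler_pXn2r _ 2)// ?nnegrE ?invr_ge0 ?sqrtr_ge0 ?(ltW ce)//.
  by rewrite exprVn sqr_sqrtr// ltW.
move=> /(ler_wpM2l C0)/le_trans; apply; rewrite mulrA ler_pdivrMr ?ltr_wpDl//.
by rewrite mulrDr mulr1 [C * e]mulrC lerDl ltW.
Qed.

Lemma family_consistent qs (e0 : R) : (forall q, q \in qs -> a <= q <= b) -> 0 < e0 ->
  exists N, forall n, (N <= n)%N -> (0 < n)%N /\ exists e, [/\ mean_le mu n e e0,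
    forall s, 0 <= e s & forall s, sample n s -> forall q, q \in qs ->
      `|ostat (F q) s - q| <= e s].
Proof.
elim: qs e0 => [|q qs IH] e0 qab e00.
  exists 1%N => n n0; split => //; exists (fun=> 0); split => //.
  by apply: (mean_leW (ltW e00)); exact: mean_le_cst.
have e20 : 0 < e0 / 2 by rewrite divr_gt0.
have [|N1 HN1] := @ostat_consistent _ _ _ _ reg q (e0 / 2) _ e20.
  by apply: qab; rewrite mem_head.
have [|N2 HN2] := IH (e0 / 2) _ e20.
  by move=> z zq; apply: qab; rewrite inE zq orbT.
exists (maxn N1 N2) => n; rewrite geq_max => /andP[/HN1[n0 [e1 [m1 p1 b1]]]].
move=> /HN2[_ [e2 [m2 p2 b2]]]; split => //; exists (fun s => e1 s + e2 s); split.
- by apply: mean_leW (mean_leD m1 m2); lra.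
- by move=> s; rewrite addr_ge0.
- move=> s ss z; rewrite inE => /predU1P[->|zq].
    by apply: le_trans (b1 _ ss) _; rewrite lerDl.
  by apply: le_trans (b2 _ ss _ zq) _; rewrite lerDr.
Qed.

(** The bound concerns the distances from the reports, and only from above, because at an endpoint
    the order statistic itself has no rate. *)
Lemma family_rate qs : (forall q, q \in qs -> a <= q <= b) ->
  exists C, 0 <= C /\ exists N, forall n, (N <= n)%N -> (0 < n)%N /\ exists e,
    [/\ mean_le mu n e (C / Num.sqrt n%:R), forall s, 0 <= e s
      & forall s, sample n s -> forall q, q \in qs -> forall x, x \in s ->
          `|x - ostat (F q) s| <= `|x - q| + e s].
Proof.
elim: qs => [|q qs IH] qab.
  exists 0; split => //; exists 1%N => n n0; split => //; exists (fun=> 0); split => //.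
  by rewrite mul0r; exact: mean_le_cst.
have [|C1 [C10 [N1 HN1]]] := @ostat_upper_rate _ _ _ _ reg q.
  by apply: qab; rewrite mem_head.
have [|C2 [C20 [N2 HN2]]] := IH.
  by move=> z zq; apply: qab; rewrite inE zq orbT.
exists (C1 + C2); split; first exact: addr_ge0.
exists (maxn N1 N2) => n; rewrite geq_max => /andP[/HN1[n0 [e1 [m1 p1 b1]]]].
move=> /HN2[_ [e2 [m2 p2 b2]]]; split => //; exists (fun s => e1 s + e2 s); split.
- by rewrite mulrDl; exact: mean_leD.
- by move=> s; rewrite addr_ge0.
- move=> s ss z; rewrite inE => /predU1P[->|zq] x xs.
    by apply: le_trans (b1 _ ss _ xs) _; rewrite lerD2l lerDl.
  by apply: le_trans (b2 _ ss _ zq _ xs) _; rewrite lerD2l lerDr.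
Qed.

Lemma SC_le (s u v : seq R) (e : R) : (0 < size s)%N ->
  (forall x, x \in s -> dist_to x u <= dist_to x v + e) -> SC s u <= SC s v + e.
Proof.
move=> s0 H; have sp : 0 < (size s)%:R :> R by rewrite ltr0n.
rewrite /SC ler_pdivrMl// mulrDr mulVKf ?gt_eqF//.
have -> : (size s)%:R * e = \sum_(x <- s) e.
  by rewrite big_const_seq count_predT iter_addr_0 mulr_natl.
by rewrite -big_split [leLHS]big_seq [leRHS]big_seq; apply: ler_sum => x /H.
Qed.

Lemma SC_ge0 (s u : seq R) : 0 <= SC s u.
Proof.
by rewrite mulr_ge0 ?invr_ge0// sumr_ge0// => x _; exact: dist_to_ge0.
Qed.

Lemma Eiid_ge0 n f : (forall s, 0 <= f s) -> (0 <= Eiid mu n f)%E.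
Proof.
move=> f0; apply: (@le_trans _ _ (Eiid mu n (fun=> 0))).
  by rewrite (iid_mean_Eiid (iid_mean_cst mu n 0)).
by apply: (le_Eiid reg) => s _; exact: f0.
Qed.

Lemma Eiid_SCv_rate qs : qs != [::] -> (forall q, q \in qs -> a <= q <= b) ->
  exists C, 0 <= C /\ exists N, forall n, (N <= n)%N -> (0 < n)%N /\
    (Eiid mu n (SCv (map F qs)) <= (fine (qcost mu qs) + C / Num.sqrt n%:R)%:E)%E.
Proof.
move=> qs0 /family_rate[C [C0 [N HN]]]; exists C; split => //; exists N => n /HN.
move=> [n0 [e [em _ eb]]]; split => //.
apply: (Eiid_le_mean reg (e := fun s => SC s qs + e s)).
  move=> s ss; rewrite /SCv PM_ostat -map_comp; apply: SC_le; first by rewrite ss.1.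
  move=> x xs; rewrite -[X in dist_to x X + _]map_id; apply: dist_to_map_le => // q qqs.
  exact: eb.
apply: mean_leD em; exists (fine (qcost mu qs)) => //.
exact: (iid_mean_SC reg).
Qed.

(** Both directions follow by moving each facility between its order statistic and its quantile. *)
Lemma Eiid_SCv_consistent qs (e0 : R) : qs != [::] ->
  (forall q, q \in qs -> a <= q <= b) -> 0 < e0 ->
  exists N, forall n, (N <= n)%N ->
    `|fine (qcost mu qs) - fine (Eiid mu n (SCv (map F qs)))| <= e0.
Proof.
move=> qs0 qab e00; have [N HN] := family_consistent qab e00.
exists N => n /HN[n0 [e [em _ eb]]].
have mSC := iid_mean_SC reg n0 qs0.
have up : (Eiid mu n (SCv (map F qs)) <= (fine (qcost mu qs) + e0)%:E)%E.
  apply: (Eiid_le_mean reg (e := fun s => SC s qs + e s)).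
    move=> s ss; rewrite /SCv PM_ostat -map_comp; apply: SC_le; first by rewrite ss.1.
    move=> x xs; rewrite -[X in dist_to x X + _]map_id; apply: dist_to_map_le => // q qqs.
    apply: (le_trans (ler_distD q x _)); rewrite lerD2l distrC; exact: eb.
  by apply: mean_leD em; exists (fine (qcost mu qs)).
have lo : ((fine (qcost mu qs) - e0)%:E <= Eiid mu n (SCv (map F qs)))%E.
  have [m mm mle] := em.
  have mm' := iid_meanD mSC (iid_meanZ (-1) mm).
  apply: (@le_trans _ _ (fine (qcost mu qs) + -1 * m)%:E); first by rewrite lee_fin; lra.
  rewrite -(iid_mean_Eiid mm'); apply: (le_Eiid reg) => s ss.
  rewrite mulN1r lerBlDr /SCv PM_ostat -map_comp; apply: SC_le; first by rewrite ss.1.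
  move=> x xs; rewrite -[X in dist_to x X <= _]map_id; apply: dist_to_map_le => // q qqs.
  by apply: (le_trans (ler_distD (ostat (F q) s) x _)); rewrite lerD2l; exact: eb.
move: up lo; case: (Eiid mu n _) => [r| |] //=.
by rewrite !lee_fin => up lo; rewrite ler_distl; apply/andP; split; lra.
Qed.

Lemma SCopt_le k (s y : seq R) : size y = k -> SCopt k s <= SC s y.
Proof.
move=> yk; apply: ge_inf; last by exists y.
by exists 0 => _ [z _ <-]; exact: SC_ge0.
Qed.

Lemma SCopt_ge k (s : seq R) (z : R) : (forall y, size y = k -> z <= SC s y) -> z <= SCopt k s.
Proof.
move=> zle; apply: lb_le_inf; last by move=> _ [y yk <-]; exact: zle.
(* A tuple of [k] zeros shows that the infimum is over a nonempty set, where [inf] is not a default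
   value. *)
by exists (SC s (nseq k 0)); exists (nseq k 0) => //=; rewrite size_nseq.
Qed.

(** Above, the fixed points [ys] are a candidate for every sample. Below, the sampling error is
    uniform in the facilities and thus survives the infimum taken sample by sample. *)
Lemma Eiid_SCopt ys k n : (0 < k)%N -> size ys = k ->
  (forall zs, size zs = k -> (qcost mu ys <= qcost mu zs)%E) -> (0 < n)%N ->
  ((fine (qcost mu ys) - 3 * (b - a) / Num.sqrt n%:R)%:E <= Eiid mu n (SCopt k) <=
     (fine (qcost mu ys))%:E)%E.
Proof.
move=> k0 ysk opt n0.
have nz (zs : seq R) : size zs = k -> zs != [::] by move=> zk; rewrite -size_eq0 zk -lt0n.
apply/andP; split; last first.
  apply: (Eiid_le_mean reg (e := fun s => SC s ys)).
    by move=> s _; exact: SCopt_le.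
  by exists (fine (qcost mu ys)) => //; apply: (iid_mean_SC reg) => //; exact: nz.
have [e [m mm mle] eb] := qcost_le_SC reg n0.
have mm' := iid_meanD (iid_mean_cst mu n (fine (qcost mu ys))) (iid_meanZ (-1) mm).
apply: (@le_trans _ _ (fine (qcost mu ys) + -1 * m)%:E); first by rewrite lee_fin; lra.
rewrite -(iid_mean_Eiid mm'); apply: (le_Eiid reg) => s ss.
apply: SCopt_ge => zs zk; rewrite mulN1r lerBlDr.
apply: le_trans (eb _ _ (nz _ zk) ss); apply: fine_le; rewrite ?(qcost_fin_num reg) ?nz//.
exact: opt.
Qed.

Lemma SCopt_le_SCv (v s : seq R) : SCopt (size v) s <= SCv v s.
Proof. by apply: SCopt_le; rewrite size_map. Qed.

End Law.

End PercentileMechanism.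

(** * Limit and rate of the approximation ratio *)

Section ApproximationRatio.
Context (R : realType) (mu : probability R R) (a b : R).
Hypothesis reg : regular_law mu a b.
Local Notation F := (cdfmu mu).
Variables (k : nat) (ys qs : seq R).
Hypotheses (k0 : (0 < k)%N) (ysk : size ys = k) (qsk : size qs = k).
Hypothesis ys_opt : forall zs, size zs = k -> (qcost mu ys <= qcost mu zs)%E.
Hypothesis W_gt0 : 0 < fine (qcost mu ys).
Hypothesis qs_ab : forall q, q \in qs -> a <= q <= b.

Let W := fine (qcost mu ys).
Let D := fine (qcost mu qs).
Let h n : R := (Num.sqrt n%:R)^-1.
Let C0 : R := 3 * (b - a).
Let opt n := fine (Eiid mu n (SCopt k)).
Let sc n := fine (Eiid mu n (SCv (map F qs))).

Let C0_ge0 : 0 <= C0.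
Proof. by have [ab _ _ _ _] := reg; rewrite mulr_ge0// subr_ge0 ltW. Qed.

Let h_ge0 n : 0 <= h n.
Proof. by rewrite invr_ge0 sqrtr_ge0. Qed.

Let qs0 : qs != [::].
Proof. by rewrite -size_eq0 qsk -lt0n. Qed.

Let optP n : (0 < n)%N -> W - C0 * h n <= opt n <= W.
Proof.
move=> n0; have := Eiid_SCopt reg k0 ysk ys_opt n0.
by rewrite /opt; case: (Eiid mu n _) => [r| |] //= ; rewrite ?lee_fin// leye_eq andbF.
Qed.

Let opt_fin n : (0 < n)%N -> Eiid mu n (SCopt k) \is a fin_num.
Proof.
move=> n0; have := Eiid_SCopt reg k0 ysk ys_opt n0.
by case: (Eiid mu n _) => [r| |] //=; rewrite leye_eq andbF.
Qed.

Let opt_large : exists N, forall n, (N <= n)%N -> (0 < n)%N /\ W / 2 <= opt n.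
Proof.
have [|N HN] := @divsqrt_small _ C0 (W / 2) C0_ge0; first by rewrite divr_gt0.
exists N => n /HN[n0 nle]; split => //; have /andP[+ _] := optP n0.
by move: nle; rewrite -/(h n); lra.
Qed.

(** The limit needs two-sided control of the numerator, hence consistency instead of the one-sided
    rate. *)
Lemma Bar_cvg : (fun n => `|Bar mu k n (map F qs) - 1|) @ \oo --> `|D / W - 1|.
Proof.
apply: cvg_norm; apply: cvgB; last exact: cvg_cst.
apply: cvgM.
  apply/cvgrPdist_le => e e0; have [N HN] := Eiid_SCv_consistent reg qs0 qs_ab e0.
  by exists N => // n Nn; exact: HN.
apply: cvgV; first by rewrite gt_eqF.
apply/cvgrPdist_le => e e0; have [N HN] := divsqrt_small C0_ge0 e0.
exists N => // n /= /HN[n0 nle]; have /andP[lo up] := optP n0.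
rewrite -/(opt n) ler_distl; apply/andP; split; rewrite -/W; first by lra.
by move: nle; rewrite -/(h n); lra.
Qed.

(** The ratio is at least 1 because the mechanism places [k] facilities and is beaten by the optimum
    on each sample. From above, the numerator is at most [D + C1 * h n] and the denominator at least
    [W - C0 * h n]. *)
Lemma Bar_rate : exists C, 0 <= C /\ exists N, forall n, (N <= n)%N -> (0 < n)%N /\
  1 <= Bar mu k n (map F qs) <= D / W + C / Num.sqrt n%:R.
Proof.
have [C1 [C10 [N1 HN1]]] := Eiid_SCv_rate reg qs0 qs_ab.
have [N2 HN2] := opt_large.
have D0 : 0 <= D by rewrite fine_ge0// qcost_ge0.
(* Solves [C * (W / 2) = D / W * C0 + C1]; since [opt n >= W / 2] for large [n], the term
   [C * h n * opt n] covers both errors. *)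
pose C := 2 * (D * C0 / W + C1) / W.
have CW : C * (W / 2) = D / W * C0 + C1 by rewrite /C; field; rewrite gt_eqF.
have Cge0 : 0 <= C.
  apply: divr_ge0; last exact: ltW.
  apply: mulr_ge0 => //; apply: addr_ge0 => //.
  by apply: divr_ge0; [exact: mulr_ge0|exact: ltW].
exists C; split => //.
exists (maxn N1 N2) => n; rewrite geq_max => /andP[/HN1[n0 up] /HN2[_ optge]].
split => //; have /andP[lo _] := optP n0.
have opt0 : 0 < opt n by apply: lt_le_trans optge; rewrite divr_gt0.
have sc_fin : Eiid mu n (SCv (map F qs)) \is a fin_num.
  rewrite ge0_fin_numE ?(le_lt_trans up) ?ltry//.
  by apply: (Eiid_ge0 reg) => s; exact: SC_ge0.
rewrite /Bar -/(opt n) -/(sc n) ler_pdivlMr// mul1r ler_pdivrMr//.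
apply/andP; split.
  apply: fine_le => //; first exact: opt_fin.
  apply: (le_Eiid reg) => s _; rewrite -qsk -(size_map F); exact: SCopt_le_SCv.
have : sc n <= D + C1 * h n by rewrite -lee_fin fineK.
move=> /le_trans; apply.
have e1 : D / W * (W - C0 * h n) <= D / W * opt n.
  by apply: ler_wpM2l => //; rewrite divr_ge0// ltW.
have e2 : C * h n * (W / 2) <= C * h n * opt n.
  by apply: ler_wpM2l => //; rewrite mulr_ge0.
have e3 : D / W * (W - C0 * h n) = D - D / W * C0 * h n.
  by field; rewrite gt_eqF.
have e4 : C * h n * (W / 2) = (D / W * C0 + C1) * h n by rewrite -CW; ring.
rewrite -/(h n) mulrDl.
have : (D / W * C0 + C1) * h n = D / W * C0 * h n + C1 * h n by ring.
by lra.
Qed.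

End ApproximationRatio.

(** * Cost of the quantiles in terms of [W1] and [Winf] *)

Section QuantileCost.
Context (R : realType).

(** The infima are taken one after the other: with [w] fixed, first over the coupling for [W1],
    where an infinite cost is harmless, then over the admissible [w] for [Winf]. *)
Lemma qcost_quantile_W k (mu mut nu nut : probability R R) a b c d
    (y yt q wt wt' : 'I_k -> R) :
  (0 < k)%N -> regular_law mu a b ->
  mu (~` [set` `[c, d]]) = 0%E -> mut (~` [set` `[c, d]]) = 0%E ->
  W1_opt k mu nu -> is_discrete_k nu y wt ->
  W1_opt k mut nut -> is_discrete_k nut yt wt' ->
  (forall j, a <= q j <= b) -> (forall j, cdfmu mu (q j) = cdfmu mut (yt j)) ->
  fine (qcost mu (map q (enum 'I_k))) <=
   fine (W1 mu nu) + fine (Winf mu mut) + 2 * fine (W1 mu mut).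
Proof.
move=> k0 reg muC mutC onu dnu onut dnut qab qF.
have m0 (f : 'I_k -> R) : map f (enum 'I_k) != [::].
  by rewrite -size_eq0 size_map size_enum_ord -lt0n.
have qfin := qcost_fin_num reg (m0 q).
have nufin : W1 mu nu \is a fin_num.
  by rewrite (W1_opt_qcost k0 onu dnu); exact: (qcost_fin_num reg).
have Wifin := Winf_fin_num muC mutC.
have W1fin : W1 mu mut \is a fin_num.
  rewrite ge0_fin_numE ?W1_ge0//; apply: le_lt_trans (W1_le_Winf _ _) _.
  by rewrite ltey_eq Wifin.
set Q := fine (qcost _ _); set V := fine (W1 mu nu).
have step w pi : coupling mu mut pi -> pi (far w) = 0%E ->
    Q - V - w <= 2 * fine (W1 mu mut).
  move=> cpi piw; suff : (((Q - V - w) / 2)%:E <= W1 mu mut)%E.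
    by rewrite -(fineK W1fin) lee_fin; lra.
  apply: le_ereal_inf_tmp => _ [pi' cpi' <-].
  have := qcost_quantile k0 reg onu dnu onut dnut cpi piw cpi' qab qF.
  rewrite -(fineK qfin) -(fineK nufin) -/Q -/V -/(transport_cost pi').
  have : (0 <= transport_cost pi')%E by exact: transport_cost_ge0.
  case: (transport_cost pi') => [r _| _ _|//]; last exact: leey.
  rewrite -!EFinD !lee_fin => ?; lra.
suff : ((Q - V - 2 * fine (W1 mu mut))%:E <= Winf mu mut)%E.
  by rewrite -(fineK Wifin) lee_fin; lra.
by apply: Winf_ge => w pi cpi piw; rewrite lee_fin; have := step _ _ cpi piw; lra.
Qed.

End QuantileCost.

(** * Percentile vectors as levels of [mu], and the final estimates *)

Lemma map_quantile (R : realType) (mu mut : probability R R) k (q yt : 'I_k -> R) :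
  (forall j, cdfmu mu (q j) = cdfmu mut (yt j)) ->
  [seq cdfmu mut (yt j) | j <- enum 'I_k] = map (cdfmu mu) (map q (enum 'I_k)).
Proof. by move=> qF; rewrite -map_comp; apply: eq_map => j /=; rewrite qF. Qed.

Theorem theorem9 (R : realType) (c d : R) (mu mut nu nut : probability R R)
  (k : nat) (y yt : 'I_k -> R) :
  c <= d ->
  mu (~` [set` `[c, d]]) = 0%E -> mut (~` [set` `[c, d]]) = 0%E ->
  standing mu ->
  (0 < k)%N ->
  W1_opt k mu nu -> sorted_support nu y ->
  W1_opt k mut nut -> sorted_support nut yt ->
  let v_mu := [seq cdfmu mu (y j) | j <- enum 'I_k] in
  let v_mut := [seq cdfmu mut (yt j) | j <- enum 'I_k] in
  let Wi := fine (Winf mu mut) in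
  let W1m := fine (W1 mu mut) in
  let W1nu := fine (W1 mu nu) in
  [/\ cvgn (fun n => `|Bar mu k n v_mut - 1|),
      limn (fun n => `|Bar mu k n v_mut - 1|) <= (Wi + 2 * W1m) / W1nu,
      (Wi + 2 * W1m) / W1nu <= 3 * (Wi / W1nu) &
      exists C : R, 0 < C /\ forall n : nat, (k < n)%N ->
        `|Bar mu k n v_mu - Bar mu k n v_mut|
          <= 3 * (Wi / W1nu) + C / Num.sqrt (n%:R)].
Proof.
move=> _ muC mutC st k0 onu [_ [wt [_ dnu]]] onut [_ [wt' [_ dnut]]] v_mu v_mut Wi W1m W1nu.
have [a [b reg]] := standing_regular st.
have [_ _ _ Fsurj _] := reg.
(* The mechanism sees only the levels, so the support points, which might lie outside [[a, b]], are
   replaced by [mu]-quantiles inside it. *)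
have quantile (mut' : probability R R) (yt' : 'I_k -> R) : exists q : 'I_k -> R,
    forall j, a <= q j <= b /\ cdfmu mu (q j) = cdfmu mut' (yt' j).
  have : forall j, exists q, a <= q <= b /\ cdfmu mu q = cdfmu mut' (yt' j).
    move=> j; have [|q qab qF] := Fsurj (cdfmu mut' (yt' j)); last by exists q.
    by rewrite cdfmu_ge0 cdfmu_le1.
  by move=> /choice[q qP]; exists q.
have [q1 q1P] := quantile mu y; have [q2 q2P] := quantile mut yt.
have v_muE : v_mu = map (cdfmu mu) (map q1 (enum 'I_k)).
  by apply: map_quantile => j; exact: (q1P j).2.
have v_mutE : v_mut = map (cdfmu mu) (map q2 (enum 'I_k)).
  by apply: map_quantile => j; exact: (q2P j).2.
set ys := map y (enum 'I_k).
have sz (f : 'I_k -> R) : size (map f (enum 'I_k)) = k.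
  by rewrite size_map size_enum_ord.
have m0 (f : 'I_k -> R) : map f (enum 'I_k) != [::] by rewrite -size_eq0 sz -lt0n.
have ys_opt zs : size zs = k -> (qcost mu ys <= qcost mu zs)%E.
  exact: W1_opt_qcost_le k0 onu dnu.
have WE : W1nu = fine (qcost mu ys) by rewrite /W1nu (W1_opt_qcost k0 onu dnu).
have W0 : 0 < W1nu.
  rewrite WE fine_gt0// qcost_gt0 ?m0//=; last by move=> x; exact: standing_set1.
  by rewrite ltey_eq (qcost_fin_num reg) ?m0.
have W0' : 0 < fine (qcost mu ys) by rewrite -WE.
have in_ab (q : 'I_k -> R) : (forall j, a <= q j <= b) ->
    forall z, z \in map q (enum 'I_k) -> a <= z <= b.
  by move=> qab z /mapP[j _ ->].
have q2ab := in_ab _ (fun j => (q2P j).1); have q1ab := in_ab _ (fun j => (q1P j).1).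
have D2 : fine (qcost mu (map q2 (enum 'I_k))) <= W1nu + Wi + 2 * W1m.
  exact: qcost_quantile_W k0 reg muC mutC onu dnu onut dnut (fun j => (q2P j).1)
    (fun j => (q2P j).2).
have D1 : fine (qcost mu (map q1 (enum 'I_k))) <= W1nu.
  have [pi cpi pi0] := diagonal_coupling mu.
  have := qcost_quantile k0 reg onu dnu onu dnu cpi pi0 cpi (fun j => (q1P j).1)
    (fun j => (q1P j).2).
  have -> : transport_cost pi = 0%E.
    apply/eqP; rewrite eq_le (transport_cost_far pi0)/=; exact: transport_cost_ge0.
  rewrite !adde0 => le1; apply: fine_le => //; first exact: (qcost_fin_num reg (m0 _)).
  by rewrite (W1_opt_qcost k0 onu dnu); exact: (qcost_fin_num reg (m0 _)).
(* By optimality the limiting ratio is at least 1, which removes the absolute value in the limit. *)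
have WD (q : 'I_k -> R) : W1nu <= fine (qcost mu (map q (enum 'I_k))).
  rewrite WE; apply: fine_le; first exact: (qcost_fin_num reg (m0 _)).
    exact: (qcost_fin_num reg (m0 _)).
  exact: ys_opt (sz q).
have Wifin := Winf_fin_num muC mutC.
have W1Wi : W1m <= Wi.
  have := W1_le_Winf mu mut; rewrite /W1m /Wi -(fineK Wifin).
  have := W1_ge0 mu mut; case: (W1 mu mut) => [r| |] //=.
have W1m0 : 0 <= W1m by rewrite fine_ge0// W1_ge0.
have cvg := Bar_cvg reg k0 (sz y) (sz q2) ys_opt W0' q2ab.
rewrite -v_mutE in cvg.
have c3 : (Wi + 2 * W1m) / W1nu <= 3 * (Wi / W1nu).
  by rewrite mulrA ler_pM2r ?invr_gt0//; lra.
split => //.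
- by apply/cvg_ex; eexists; exact: cvg.
- rewrite (cvg_lim _ cvg)//= -WE ger0_norm; last first.
    by rewrite subr_ge0 ler_pdivlMr// mul1r WD.
  by rewrite lerBlDr ler_pdivrMr// mulrDl mul1r divfK ?gt_eqF//; lra.
have [C1 [C10 [N1 HN1]]] := Bar_rate reg k0 (sz y) (sz q1) ys_opt W0' q1ab.
have [C2 [C20 [N2 HN2]]] := Bar_rate reg k0 (sz y) (sz q2) ys_opt W0' q2ab.
pose diff n := `|Bar mu k n v_mu - Bar mu k n v_mut|.
have diff0 n : 0 <= diff n by exact: normr_ge0.
(* For [n] below the threshold, [diff n * sqrt n] is itself a summand of [C3]. *)
pose C3 := \sum_(n < maxn N1 N2) diff n * Num.sqrt n%:R.
have C30 : 0 <= C3 by apply: sumr_ge0 => n _; rewrite mulr_ge0 ?sqrtr_ge0 ?diff0.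
exists (C1 + C2 + C3 + 1); split; first by rewrite ltr_wpDl// !addr_ge0.
move=> n kn; have n0 : (0 < n)%N by exact: leq_ltn_trans kn.
have s0 : 0 < Num.sqrt n%:R :> R by rewrite sqrtr_gt0 ltr0n.
have Wi0 : 0 <= 3 * (Wi / W1nu).
  by rewrite mulr_ge0// divr_ge0 ?(ltW W0)// (le_trans W1m0).
have [Nn|nN] := leqP (maxn N1 N2) n; last first.
  have : diff n <= C3 / Num.sqrt n%:R.
    rewrite ler_pdivlMr// /C3 (bigD1 (Ordinal nN))//= lerDl.
    by apply: sumr_ge0 => i _; rewrite mulr_ge0 ?sqrtr_ge0 ?diff0.
  move=> /le_trans; apply; rewrite -[leLHS]add0r lerD// ler_pM2r ?invr_gt0//.
  by lra.
move: Nn; rewrite geq_max => /andP[/HN1[_ +] /HN2[_ +]].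
rewrite -v_muE -v_mutE -WE => /andP[l1 u1] /andP[l2 u2].
(* Up to [O(1 / sqrt n)], the ratio for [v_mu] is at most 1 and the one for [v_mut] at most
   [1 + 3 * (Wi / W1nu)]. As both are at least 1, this bounds their difference in either order. *)
have d1 : fine (qcost mu (map q1 (enum 'I_k))) / W1nu <= 1.
  by rewrite ler_pdivrMr// mul1r.
have d2 : fine (qcost mu (map q2 (enum 'I_k))) / W1nu <= 1 + 3 * (Wi / W1nu).
  apply: (@le_trans _ _ (1 + (Wi + 2 * W1m) / W1nu)); last by rewrite lerD2l.
  by rewrite ler_pdivrMr// mulrDl mul1r divfK ?gt_eqF//; lra.
have p3 : 0 <= C3 / Num.sqrt n%:R by rewrite divr_ge0// ltW.
have p1 : 0 <= C1 / Num.sqrt n%:R by rewrite divr_ge0// ltW.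
have p2 : 0 <= C2 / Num.sqrt n%:R by rewrite divr_ge0// ltW.
have p4 : 0 <= 1 / Num.sqrt n%:R :> R by rewrite divr_ge0// ltW.
by rewrite !mulrDl ler_distl; apply/andP; split; lra.
Qed.
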